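(* Let $n\ge 2$ and $\ell\ge 1$ be integers. There is a pair of natural numbers $(r,\ell')$ with $r\ge 2$, $0\le \ell'<\ell<r$ and $\ell'+\ell\equiv 1-n \pmod r$, such that the $B_n$-module $\boldsymbol N_{n,\ell,\ell'}$ (formed for this $r$) is a non-trivial extension of $\boldsymbol W_{n,\ell'}$ by $\boldsymbol W_{n,\ell}$; that is, there is a short exact sequence of $B_n$-modules $$0\longrightarrow \boldsymbol W_{n,\ell}\hookrightarrow \boldsymbol N_{n,\ell,\ell'}\longrightarrow \boldsymbol W_{n,\ell'}\longrightarrow 0$$ (the first map being the inclusion) and it does not split. Furthermore, the center of the braid group $B_n$ acts faithfully on $\boldsymbol N_{n,\ell,\ell'}$.
   Context: $B_n$ is the braid group on $n$ strands with Artin generators $\sigma_1,\dots,\sigma_{n-1}$. Let $r\ge 2$, $q=e^{\pi i/r}$, $s=q^{r-1}=-q^{-1}$, $\{x\}=q^x-q^{-x}$, $[x]=\{x\}/\{1\}$, $[m]!=[m]\cdots[1]$, $\begin{bmatrix} a\\ b\end{bmatrix}=\frac{[a]!}{[a-b]!\,[b]!}$ for $0\le b\le a<r$. Let $V$ (the Steinberg module $\mathsf V_{r-1}$ of restricted quantum $\mathfrak{sl}(2)$) be the complex vector space with basis $u_0,\dots,u_{r-1}$ (put $u_{-1}=u_r=0$) and operators $E u_m=u_{m-1}$, $F u_m=[m+1][r-1-m]\,u_{m+1}$, $K u_m=s q^{-2m}u_m$. On $V^{\otimes n}$, $E$ acts as $\sum_{i=1}^n 1^{\otimes (i-1)}\otimes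 E\otimes K^{\otimes (n-i)}$ and $F$ as $\sum_{i=1}^n (K^{-1})^{\otimes (i-1)}\otimes F\otimes 1^{\otimes (n-i)}$. Let $\mathsf R:V\otimes V\to V\otimes V$ be $$\mathsf R(u_i\otimes u_j)=s^{-(i+j)}\sum_{a=0}^{\min(i,r-j-1)} q^{2(i-a)(j+a)}q^{a(a-1)/2}\begin{bmatrix} a+j\\ j\end{bmatrix}\prod_{m=0}^{a-1}\{m+j+1\}\;u_{j+a}\otimes u_{i-a}.$$ $B_n$ acts on $V^{\otimes n}$ by $\sigma_i=1^{\otimes(i-1)}\otimes \mathsf R\otimes 1^{\otimes(n-i-1)}$; this action commutes with $E$ and $F$. For $\ell\in\mathbb N$ let $\boldsymbol V_{n,\ell}=\mathrm{span}\{u_{\varepsilon_1}\otimes\cdots\otimes u_{\varepsilon_n}: 0\le\varepsilon_i\le r-1,\ \varepsilon_1+\dots+\varepsilon_n=\ell\}$, $\boldsymbol W_{n,\ell}=\ker(E)\cap\boldsymbol V_{n,\ell}$. When $0\le \ell'<\ell<r$ and $\ell'\equiv 1-n-\ell \pmod r$, put $\boldsymbol N_{n,\ell,\ell'}=\ker\big((FE)^2\big)\cap \boldsymbol V_{n,\ell}$. All of these are $B_n$-submodules of $V^{\otimes n}$. *)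

(* Defs.v *)
From HB Require Import structures.
From mathcomp Require Import all_boot all_order all_algebra.
From mathcomp Require Import generic_quotient boolp reals trigo.
From mathcomp Require Import complex.
Set Implicit Arguments.
Unset Strict Implicit.
Unset Printing Implicit Defensive.

Import Order.TTheory GRing.Theory Num.Theory.
Local Open Scope ring_scope.
Local Open Scope quotient_scope.

(* The braid group on n strands: words in the letters (i, false) = sigma_i and
   (i, true) = sigma_i^-1, modulo the Artin relations.  Generators are indexed
   from 0, so sigma_i braids the strands i and i+1 among 0, ..., n-1. *)
Section BraidGroup.
Variable n : nat.

Definition braid_word := seq ('I_n.-1 * bool).

Inductive braid_rel : braid_word -> braid_word -> Prop :=
| braid_refl w : braid_rel w w
| braid_sym v w : braid_rel v w -> braid_rel w v
| braid_trans u v w : braid_rel u v -> braid_rel v w -> braid_rel u w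
| braid_cat v v' w w' :
    braid_rel v v' -> braid_rel w w' -> braid_rel (v ++ w) (v' ++ w')
| braid_cancel i b : braid_rel [:: (i, b); (i, ~~ b)] [::]
| braid_far (i j : 'I_n.-1) : (i.+1 < j)%N ->
    braid_rel [:: (i, false); (j, false)] [:: (j, false); (i, false)]
| braid_yb (i j : 'I_n.-1) : j = i.+1 :> nat ->
    braid_rel [:: (i, false); (j, false); (i, false)]
              [:: (j, false); (i, false); (j, false)].

Definition braid_relb : rel braid_word := fun v w => `[< braid_rel v w >].

Lemma braid_relb_refl : reflexive braid_relb.
Proof. by move=> w; apply/asboolP; apply: braid_refl. Qed.

Lemma braid_relb_sym : symmetric braid_relb.
Proof. by move=> v w; apply/asboolP/asboolP; apply: braid_sym. Qed.

Lemma braid_relb_trans : transitive braid_relb.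
Proof.
by move=> v u w /asboolP uv /asboolP vw; apply/asboolP; apply: braid_trans vw.
Qed.

Canonical braid_equiv :=
  EquivRel braid_relb braid_relb_refl braid_relb_sym braid_relb_trans.

Definition braid := {eq_quot braid_equiv}.

HB.instance Definition _ := Choice.on braid.
HB.instance Definition _ := EqQuotient.on braid.

Lemma braid_eqP (v w : braid_word) :
  \pi_braid v = \pi_braid w <-> braid_rel v w.
Proof.
split=> [/eqP | vw]; first by rewrite piE => /asboolP.
by apply/eqP; rewrite piE; apply/asboolP.
Qed.

Definition inv_word (w : braid_word) : braid_word :=
  rev [seq (x.1, ~~ x.2) | x <- w].

Lemma inv_word_cat v w : inv_word (v ++ w) = inv_word w ++ inv_word v.
Proof. by rewrite /inv_word map_cat rev_cat. Qed.

Lemma inv_wordK : involutive inv_word.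
Proof.
move=> w; rewrite /inv_word map_rev revK -map_comp -[RHS]map_id.
by apply: eq_map => -[i b] /=; rewrite negbK.
Qed.

Lemma mul_word_inv w : braid_rel (w ++ inv_word w) [::].
Proof.
elim: w => [|[i b] w IHw]; first exact: braid_refl.
rewrite -cat1s inv_word_cat !catA -(catA [:: (i, b)]).
apply: braid_trans (braid_cancel i b).
rewrite -[RHS in braid_rel _ RHS]/([:: (i, b)] ++ inv_word [:: (i, b)]).
apply: braid_cat; last exact: braid_refl.
rewrite -[X in braid_rel _ X]cats0.
by apply: braid_cat => //; apply: braid_refl.
Qed.

Lemma inv_word_mul w : braid_rel (inv_word w ++ w) [::].
Proof. by have := mul_word_inv (inv_word w); rewrite inv_wordK. Qed.

Lemma inv_word_rel v w : braid_rel v w -> braid_rel (inv_word v) (inv_word w).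
Proof.
move=> vw; apply: (@braid_trans _ (inv_word v ++ (w ++ inv_word w))).
  rewrite -[X in braid_rel X _]cats0; apply: braid_cat; first exact: braid_refl.
  exact/braid_sym/mul_word_inv.
rewrite catA -[X in braid_rel _ X]cat0s; apply: braid_cat; last exact: braid_refl.
apply: braid_trans (inv_word_mul v).
by apply: braid_cat; [apply: braid_refl | apply: braid_sym].
Qed.

Definition braid_one : braid := \pi_braid [::].
Definition braid_mul (x y : braid) : braid := \pi_braid (repr x ++ repr y).
Definition braid_inv (x : braid) : braid := \pi_braid (inv_word (repr x)).

Lemma repr_pi_rel w : braid_rel (repr (\pi_braid w)) w.
Proof. by apply/braid_eqP; rewrite reprK. Qed.

Lemma braid_mulE v w :
  braid_mul (\pi_braid v) (\pi_braid w) = \pi_braid (v ++ w).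
Proof. by apply/braid_eqP; apply: braid_cat; apply: repr_pi_rel. Qed.

Lemma braid_invE w : braid_inv (\pi_braid w) = \pi_braid (inv_word w).
Proof. exact/braid_eqP/inv_word_rel/repr_pi_rel. Qed.

Lemma braid_mulA : associative braid_mul.
Proof.
move=> x y z; apply/braid_eqP.
apply: (@braid_trans _ (repr x ++ (repr y ++ repr z))).
  by apply: braid_cat; [apply: braid_refl | apply: repr_pi_rel].
rewrite catA; apply: braid_sym.
by apply: braid_cat; [apply: repr_pi_rel | apply: braid_refl].
Qed.

Lemma braid_mul1 : left_id braid_one braid_mul.
Proof. by move=> x; rewrite -{1}(reprK x) /braid_one braid_mulE reprK. Qed.

Lemma braid_mulr1 : right_id braid_one braid_mul.
Proof. by move=> x; rewrite -{1}(reprK x) /braid_one braid_mulE cats0 reprK. Qed.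

Lemma braid_mulV : left_inverse braid_one braid_inv braid_mul.
Proof.
move=> x; apply/braid_eqP; apply: braid_trans (inv_word_mul (repr x)).
by apply: braid_cat; [apply: repr_pi_rel | apply: braid_refl].
Qed.

Lemma braid_mulrV : right_inverse braid_one braid_inv braid_mul.
Proof.
move=> x; apply/braid_eqP; apply: braid_trans (mul_word_inv (repr x)).
by apply: braid_cat; [apply: braid_refl | apply: repr_pi_rel].
Qed.

HB.instance Definition _ := isGroup.Build braid
  braid_mulA braid_mul1 braid_mulr1 braid_mulV braid_mulrV.

Definition artin (i : 'I_n.-1) : braid := \pi_braid [:: (i, false)].

End BraidGroup.

Definition central (G : groupType) (z : G) : Prop := forall g : G, commute z g.

(* Modules over a group G, presented as subspaces U of an ambient
   representation rho : G -> End(vT).  Linear maps between subspaces are given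
   by endomorphisms of vT, of which only the restriction matters. *)
Section Modules.
Variables (G : groupType) (K : fieldType) (vT : vectType K).
Variable rho : G -> 'End(vT).
Implicit Types A B N : {vspace vT}.

Definition is_rep : Prop :=
  rho 1%g = \1%VF /\ forall g h : G, rho (g * h)%g = (rho g \o rho h)%VF.

Definition submodule A : Prop := forall g : G, (rho g @: A <= A)%VS.

Definition module_hom A B (f : 'End(vT)) : Prop :=
  (f @: A <= B)%VS /\
  forall (g : G) (v : vT), v \in A -> f (rho g v) = rho g (f v).

(* 0 -> A -> N -> B -> 0, where the first map is the inclusion of A in N and
   the second is p. *)
Definition short_exact A N B (p : 'End(vT)) : Prop :=
  [/\ [/\ submodule A, submodule N & submodule B],
      (A <= N)%VS, module_hom N B p,
      (p @: N)%VS = B & (N :&: lker p)%VS = A].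

Definition splits N B (p : 'End(vT)) : Prop :=
  exists2 t : 'End(vT), module_hom B N t & {in B, forall v, p (t v) = v}.

Definition nontrivial_extension B A N : Prop :=
  exists2 p : 'End(vT), short_exact A N B p & ~ splits N B p.

Definition center_faithful_on N : Prop :=
  forall z : G, central z -> {in N, forall v, rho z v = v} -> z = 1%g.

End Modules.

Section FreeSpace.
Variables (C : fieldType) (I : finType).

Definition bvec (x : I) : {ffun I -> C^o} := [ffun y => (y == x)%:R].

Definition linext_fun (vT : vectType C) (f : I -> vT) (v : {ffun I -> C^o}) : vT :=
  \sum_x (v x : C) *: f x.

Lemma linext_is_linear (vT : vectType C) (f : I -> vT) : linear (linext_fun f).
Proof.
move=> a v w; rewrite /linext_fun scaler_sumr -big_split /=.
by apply: eq_bigr => x _; rewrite !ffunE scalerDl scalerA.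
Qed.

HB.instance Definition _ (vT : vectType C) (f : I -> vT) :=
  GRing.isLinear.Build C {ffun I -> C^o} vT *:%R (linext_fun f)
    (linext_is_linear f).

Definition linext (vT : vectType C) (f : I -> vT) :
  'Hom({ffun I -> C^o}, vT) := linfun (linext_fun f).

Lemma linextE (vT : vectType C) (f : I -> vT) x : linext f (bvec x) = f x.
Proof.
rewrite lfunE /= /linext_fun (bigD1 x) //= ffunE eqxx scale1r big1 ?addr0 //.
by move=> y /negbTE yx; rewrite ffunE yx scale0r.
Qed.

End FreeSpace.

Section Steinberg.
Variables (R : realType) (r : nat).
Local Notation C := (R[i]).

(* exp(pi i / r) *)
Definition q : C := (cos (pi / r%:R) +i* sin (pi / r%:R))%C.
Definition s : C := q ^+ r.-1.

Definition qbrace (x : nat) : C := q ^+ x - q ^- x.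
Definition qint (x : nat) : C := qbrace x / qbrace 1.
Definition qfact (m : nat) : C := \prod_(1 <= k < m.+1) qint k.
Definition qbinom (a b : nat) : C := qfact a / (qfact (a - b) * qfact b).

(* V with basis u_0, ..., u_{r-1}; uV m = 0 for m >= r. *)
Definition V := {ffun 'I_r -> C^o}.
Definition uV (m : nat) : V := [ffun j : 'I_r => (j == m :> nat)%:R].

Definition opE : 'End(V) :=
  linext (fun m : 'I_r => if m == 0 :> nat then 0 else uV m.-1).
Definition opF : 'End(V) :=
  linext (fun m : 'I_r => (qint m.+1 * qint (r.-1 - m)) *: uV m.+1).
Definition opK : 'End(V) :=
  linext (fun m : 'I_r => (s * q ^- (2 * m)) *: uV m).

(* V (x) V, with basis the u_i (x) u_j. *)
Definition V2 := {ffun 'I_r * 'I_r -> C^o}.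
Definition tens2 (x y : V) : V2 := [ffun p => (x p.1 : C) * y p.2].

Definition Rmat : 'End(V2) :=
  linext (fun p : 'I_r * 'I_r => let i : nat := p.1 in let j : nat := p.2 in
    s ^- (i + j) *: \sum_(0 <= a < (minn i (r - j - 1)).+1)
      (q ^+ (2 * (i - a) * (j + a)) * q ^+ ((a * a.-1) %/ 2)
       * qbinom (a + j) j * \prod_(0 <= m < a) qbrace (m + j + 1))
      *: tens2 (uV (j + a)) (uV (i - a))).

Section TensorPower.
Variable n : nat.

(* The n-th tensor power of V: bvec e, for e : {ffun 'I_n -> 'I_r}, stands for
   u_{e 0} (x) ... (x) u_{e (n-1)}. *)
Definition Vn := {ffun {ffun 'I_n -> 'I_r} -> C^o}.

Definition tens (x : 'I_n -> V) : Vn :=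
  [ffun e : {ffun 'I_n -> 'I_r} => \prod_k (x k (e k) : C)].

Definition tens_op (A : 'I_n -> 'End(V)) : 'End(Vn) :=
  linext (fun e : {ffun 'I_n -> 'I_r} => tens (fun k => A k (bvec C (e k)))).

Definition nE : 'End(Vn) := \sum_(i < n) tens_op (fun k =>
  if (k < i)%N then \1%VF else if k == i then opE else opK).
Definition nF : 'End(Vn) := \sum_(i < n) tens_op (fun k =>
  if (k < i)%N then (opK^-1)%VF else if k == i then opF else \1%VF).

Lemma left_strand_subproof (i : 'I_n.-1) : (i < n)%N.
Proof. exact: leq_trans (ltn_ord i) (leq_pred n). Qed.
Lemma right_strand_subproof (i : 'I_n.-1) : (i.+1 < n)%N.
Proof. by case: n i => [|m] [i Hi]. Qed.
Definition left_strand (i : 'I_n.-1) : 'I_n := Ordinal (left_strand_subproof i).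
Definition right_strand (i : 'I_n.-1) : 'I_n :=
  Ordinal (right_strand_subproof i).

(* 1 (x) ... (x) Rmat (x) ... (x) 1, with Rmat at the strands i and i+1:
   the coefficient of u_a (x) u_b in Rmat (u_{e i} (x) u_{e (i+1)}) multiplies
   bvec e with its entries i, i+1 replaced by a, b. *)
Definition nR (i : 'I_n.-1) : 'End(Vn) :=
  linext (fun e : {ffun 'I_n -> 'I_r} =>
    \sum_(p : 'I_r * 'I_r)
      (Rmat (bvec C (e (left_strand i), e (right_strand i))) p : C) *:
      bvec C [ffun k => if k == left_strand i then p.1
                        else if k == right_strand i then p.2 else e k]).

(* The action of the braid group is the representation with sigma_i acting by
   nR i; it is unique since the sigma_i generate. *)
Definition is_braid_action (rho : braid n -> 'End(Vn)) : Prop :=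
  is_rep rho /\ forall i : 'I_n.-1, rho (artin i) = nR i.

Definition Vnl (l : nat) : {vspace Vn} :=
  <<[seq bvec C e | e : {ffun 'I_n -> 'I_r} <- enum {ffun 'I_n -> 'I_r}
                  & (\sum_i e i)%N == l]>>%VS.
Definition Wnl (l : nat) : {vspace Vn} := (lker nE :&: Vnl l)%VS.

(* The second weight l' enters only through the conditions
   l' < l < r and l' + l = 1 - n mod r under which this space is considered. *)
Definition Nnl (l l' : nat) : {vspace Vn} :=
  (lker ((nF \o nE) \o (nF \o nE)) :&: Vnl l)%VS.

End TensorPower.
End Steinberg.

(* Main.v *)
(* Take l' = l - 1 and r = n + 2l - 2.  On the weight space of weight l - 1 the
   commutator [E,F] is the quantum integer of r, hence zero; since E is onto and
   F is injective in the weights involved, E maps N onto W_{n,l'} with kernel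
   W_{n,l}.

   A vector killed by E is determined by its slices along the last tensor
   factor, so sigma_1 ... sigma_(n-1), which commutes with E, must act on it as a
   rotation of the tensor factors up to explicit scalars.  The same comparison on
   vectors killed by E^2 shows that the full twist acts on N as
   theta (1 + c FE) with theta and c nonzero.  As FE is nonzero of square zero on
   N, the extension does not split and the full twist has infinite order on N.

   The action exists because V is generated by u_0 under F: an identity between
   operators commuting with F need only be checked on vectors whose first tensor
   factor is u_0, where the braid relation and the commutation of R with E are
   immediate.

   Finally, the centre of B_n consists of powers of the half twist Delta, up to
   full twists: by Garside's theorem a quasicentral positive braid divisible by
   one generator is divisible by all of them, hence by Delta. *)

Require Import Defs.
From mathcomp Require Import all_boot all_order all_algebra.
From mathcomp Require Import reals complex.
From mathcomp Require Import generic_quotient boolp trigo.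
From mathcomp Require Import ring zify.
Set Implicit Arguments.
Unset Strict Implicit.
Unset Printing Implicit Defensive.
Import Order.TTheory GRing.Theory Num.Theory.
Local Open Scope quotient_scope.

(** * The positive braid monoid *)

(** On the group side the obstacle is that equality of braid words is only given by generators of a
    congruence. It is replaced by a relation on positive words for which cancellation is free, and
    fractions whose denominator is a power of the full twist carry the conclusions over to the
    group. On the module side, tensors become coefficient functions on words of natural numbers, so
    that [E], [F] and [R] are recursions along the word. The full sum defining [R] enters only one
    commutation, the one with [F]; the one with [E] then passes from [phi] to [F phi], because the
    commutator of [E] and [F] is a scalar depending on length and weight, both preserved by [R]. The
    choice [l' = l - 1] makes [E] itself the projection of the extension, and the weights involved
    stay below [r], so the truncation of [V] at [u_r] is never felt there. Faithfulness needs no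
    more about a central [z] than an equation [z T^k = Delta^m] between [z], the full twist [T] and
    the half twist [Delta]. *)

Definition far (i j : nat) : bool := (i.+1 < j) || (j.+1 < i).
Definition adj (i j : nat) : bool := (i.+1 == j) || (j.+1 == i).

Lemma far_sym i j : far i j = far j i. Proof. by rewrite /far orbC. Qed.
Lemma adj_sym i j : adj i j = adj j i. Proof. by rewrite /adj orbC. Qed.

(* Equality in the positive braid monoid, the letter [i] standing for
   [sigma_i].  Garside's description of [i x = j y] is built into the
   constructors: cancellation is then an inversion, and the content of his
   theorem is that this relation is transitive. *)
Inductive pe : seq nat -> seq nat -> Prop :=
| pe_nil : pe [::] [::]
| pe_cons i x y : pe x y -> pe (i :: x) (i :: y)
| pe_far i j x y z : far i j ->
    pe x (j :: z) -> pe y (i :: z) -> pe (i :: x) (j :: y)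
| pe_adj i j x y z : adj i j ->
    pe x [:: j, i & z] -> pe y [:: i, j & z] -> pe (i :: x) (j :: y).

Lemma pe_refl x : pe x x.
Proof. by elim: x => [|i x IH]; constructor. Qed.
#[local] Hint Resolve pe_refl : core.

Lemma pe_sym x y : pe x y -> pe y x.
Proof.
elim=> [|i u v _ IH|i j u v z ij uz _ vz _|i j u v z ij uz _ vz _].
- exact: pe_nil.
- exact: pe_cons.
- by apply: (@pe_far _ _ _ _ z); rewrite // far_sym.
- by apply: (@pe_adj _ _ _ _ z); rewrite // adj_sym.
Qed.

Lemma pe_size x y : pe x y -> size x = size y.
Proof.
by elim=> //= [i u v _ -> //|i j u v z _ _ -> _ ->|i j u v z _ _ -> _ ->].
Qed.

Lemma pe_inv i j x y : pe (i :: x) (j :: y) ->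
  [\/ i = j /\ pe x y,
      far i j /\ (exists2 z, pe x (j :: z) & pe y (i :: z))
    | adj i j /\ (exists2 z, pe x [:: j, i & z] & pe y [:: i, j & z])].
Proof.
move=> H; inversion H; subst.
- by constructor 1.
- by constructor 2; split=> //; exists z.
- by constructor 3; split=> //; exists z.
Qed.

Lemma pe_cancel i x y : pe (i :: x) (i :: y) -> pe x y.
Proof. by case/pe_inv => -[] // H; move: H; rewrite /far /adj; lia. Qed.

Lemma pe_far_inv i j x y : far i j -> pe (i :: x) (j :: y) ->
  exists2 z, pe x (j :: z) & pe y (i :: z).
Proof. by move=> ij /pe_inv[] [] // H; move: ij H; rewrite /far /adj; lia. Qed.

Lemma pe_adj_inv i j x y : adj i j -> pe (i :: x) (j :: y) ->
  exists2 z, pe x [:: j, i & z] & pe y [:: i, j & z].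
Proof. by move=> ij /pe_inv[] [] // H; move: ij H; rewrite /far /adj; lia. Qed.

Lemma pe_swap i j t : far i j -> pe [:: i, j & t] [:: j, i & t].
Proof. by move=> ij; apply: (@pe_far _ _ _ _ t). Qed.
Lemma pe_braid i j t : adj i j -> pe [:: i, j, i & t] [:: j, i, j & t].
Proof. by move=> ij; apply: (@pe_adj _ _ _ _ t). Qed.


Ltac size_lia :=
  repeat match goal with H : pe _ _ |- _ => move/pe_size: (H); clear H end;
  rewrite /=; lia.
Ltac far_lia := unfold far, adj in *; lia.
Ltac pe_step := repeat apply: pe_cons;
  solve [ assumption | apply: pe_sym; assumption
        | apply: pe_swap; far_lia | apply: pe_braid; far_lia ].

(** * Garside's theorem: transitivity of [pe] *)

Section TransitivityStep.
Variable N : nat.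
Hypothesis tr : forall x y z, size y <= N -> pe x y -> pe y z -> pe x z.
Ltac via w := apply: (@tr _ w); [size_lia | pe_step | ].

(** The middle word is [k :: y]. Words of the length of [y] may already be compared transitively, so
    [i :: z] and [j :: z'] are related; inverting this relation yields the word that witnesses the
    relation of [i :: x] to [j :: w]. *)
Lemma pe_trans_far_far i j k x y z z' w : size y <= N ->
  far i k -> pe x (k :: z) -> pe y (i :: z) ->
  far k j -> pe y (j :: z') -> pe w (k :: z') -> pe (i :: x) (j :: w).
Proof.
move=> sy ik xz yz kj yz' wz'.
have zz' : pe (i :: z) (j :: z') by via y.
case/pe_inv: (zz') => [[eij e]|[ij [t e e']]|[ij [t e e']]].
- subst j; apply: pe_cons; via (k :: z); via (k :: z'); pe_step.
- apply: (@pe_far _ _ _ _ (k :: t)) => //.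
    via (k :: z); via (k :: j :: t); pe_step.
  via (k :: z'); via (k :: i :: t); pe_step.
- apply: (@pe_adj _ _ _ _ (k :: t)) => //.
    via (k :: z); via (k :: j :: i :: t); via (j :: k :: i :: t); pe_step.
  via (k :: z'); via (k :: i :: j :: t); via (i :: k :: j :: t); pe_step.
Qed.

Lemma pe_trans_far_adj i j k x y z z' w : size y <= N ->
  far i k -> pe x (k :: z) -> pe y (i :: z) ->
  adj k j -> pe y [:: j, k & z'] -> pe w [:: k, j & z'] -> pe (i :: x) (j :: w).
Proof.
move=> sy ik xz yz kj yz' wz'.
have zz' : pe (i :: z) [:: j, k & z'] by via y.
case/pe_inv: (zz') => [[eij e]|[ij [t e e']]|[ij [t e e']]].
- by move: ik kj; rewrite eij /far /adj; lia.
- have [t' z't' tt'] := pe_far_inv (etrans (far_sym _ _) ik) e'.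
  apply: (@pe_far _ _ _ _ [:: k, j & t']) => //.
    via (k :: z); via [:: k, j & t]; via [:: k, j, k & t']; pe_step.
  via [:: k, j & z']; via [:: k, j, i & t']; via [:: k, i, j & t'].
  pe_step.
(* The letters form a path [i - j - k]. Their common multiple is the half twist on four strands, of
   length six, and the rewriting runs through its reduced words. *)
- have [t' z't' tt'] := pe_far_inv (etrans (far_sym _ _) ik) e'.
  have [t2 tt2 t't2] := pe_adj_inv (etrans (adj_sym _ _) kj) tt'.
  apply: (@pe_adj _ _ _ _ [:: k, j, i & t2]) => //.
    via (k :: z); via [:: k, j, i & t]; via [:: k, j, i, k, j & t2].
    via [:: k, j, k, i, j & t2]; via [:: j, k, j, i, j & t2].
    via [:: j, k, i, j, i & t2]; pe_step.
  via [:: k, j & z']; via [:: k, j, i & t']; via [:: k, j, i, j, k & t2].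
  via [:: k, i, j, i, k & t2]; via [:: i, k, j, i, k & t2].
  via [:: i, k, j, k, i & t2]; pe_step.
Qed.

Lemma pe_trans_adj_adj i j k x y z z' w : size y <= N ->
  adj i k -> pe x [:: k, i & z] -> pe y [:: i, k & z] ->
  adj k j -> pe y [:: j, k & z'] -> pe w [:: k, j & z'] -> pe (i :: x) (j :: w).
Proof.
move=> sy ik xz yz kj yz' wz'.
have zz' : pe [:: i, k & z] [:: j, k & z'] by via y.
case/pe_inv: (zz') => [[eij e]|[ij [t e e']]|[ij [t e e']]].
- subst j; have {}e := pe_cancel e.
  apply: pe_cons; via [:: k, i & z]; via [:: k, i & z']; pe_step.
- have [p zp tp] := pe_adj_inv kj e.
  have [p' zp' tp'] := pe_adj_inv (etrans (adj_sym _ _) ik) e'.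
  have pp' : pe [:: k, j & p] [:: k, i & p'] by via t.
  have [u pu p'u] := pe_far_inv (etrans (far_sym _ _) ij)
                       (pe_cancel pp').
  apply: (@pe_far _ _ _ _ [:: k, i, j, k & u]) => //.
    via [:: k, i & z]; via [:: k, i, j, k & p]; via [:: k, i, j, k, i & u].
    via [:: k, j, i, k, i & u]; via [:: k, j, k, i, k & u].
    via [:: j, k, j, i, k & u]; pe_step.
  via [:: k, j & z']; via [:: k, j, i, k & p']; via [:: k, j, i, k, j & u].
  via [:: k, i, j, k, j & u]; via [:: k, i, k, j, k & u].
  pe_step.
- by move: ik kj ij; rewrite /adj; lia.
Qed.

End TransitivityStep.

(** Induction on the length of the middle word, whose first letter is compared with those of the
    outer words. The case adjacent-far is far-adjacent read backwards. *)
Lemma pe_trans x y z : pe x y -> pe y z -> pe x z.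
Proof.
have [N] := ubnP (size y); elim: N x y z => // N IH x y z sy.
have tr u v w : size v <= N -> size v < N -> pe u v -> pe v w -> pe u w.
  by move=> _; apply: IH.
case: N IH sy tr => [|N] IH sy tr.
  by case: y sy => // _ /pe_size /= /size0nil -> /pe_sym /pe_size /= /size0nil ->.
have {}tr u v w : size v <= N -> pe u v -> pe v w -> pe u w.
  by move=> h; apply: tr => //; lia.
move=> xy yz; case: y sy xy yz => [|k y] sy xy yz.
  by have /= /size0nil -> := pe_size xy; have /= /esym /size0nil -> := pe_size yz.
case: x xy => [/pe_size //|i x] xy; case: z yz => [/pe_size //|j w] yz.
have {}sy : size y <= N by move: sy => /=; lia.
case/pe_inv: xy => [[eik e]|[ik [u xu yu]]|[ik [u xu yu]]].
- rewrite eik; case/pe_inv: yz => [[ekj e']|[kj [v yv wv]]|[kj [v yv wv]]].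
  + by rewrite -ekj; apply: pe_cons; apply: tr e'.
  + by apply: (@pe_far _ _ _ _ v) => //; apply: tr yv.
  + by apply: (@pe_adj _ _ _ _ v) => //; apply: tr yv.
- case/pe_inv: yz => [[ekj e']|[kj [v yv wv]]|[kj [v yv wv]]].
  + rewrite -ekj; apply: (@pe_far _ _ _ _ u) => //.
    by apply: tr (pe_sym e') _; rewrite // -(pe_size e').
  + exact: (pe_trans_far_far tr sy ik xu yu kj yv wv).
  + exact: (pe_trans_far_adj tr sy ik xu yu kj yv wv).
- case/pe_inv: yz => [[ekj e']|[kj [v yv wv]]|[kj [v yv wv]]].
  + rewrite -ekj; apply: (@pe_adj _ _ _ _ u) => //.
    by apply: tr (pe_sym e') _; rewrite // -(pe_size e').
  + rewrite far_sym in kj; rewrite adj_sym in ik.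
    exact/pe_sym/(pe_trans_far_adj tr sy kj wv yv ik yu xu).
  + exact: (pe_trans_adj_adj tr sy ik xu yu kj yv wv).
Qed.

Lemma pe_catl u x y : pe x y -> pe (u ++ x) (u ++ y).
Proof. by move=> xy; elim: u => //= i u; apply: pe_cons. Qed.

Lemma pe_catr u x y : pe x y -> pe (x ++ u) (y ++ u).
Proof.
elim=> //= [i v w _ IH|i j v w z ij _ IHv _ IHw|i j v w z ij _ IHv _ IHw].
- exact: pe_cons.
- exact: (pe_far ij IHv IHw).
- exact: (pe_adj ij IHv IHw).
Qed.

Lemma pe_catI u x y : pe (u ++ x) (u ++ y) -> pe x y.
Proof. by elim: u => //= i u IH /pe_cancel. Qed.

(** The constructors of [pe] only look at first letters; reversal transports facts to the right end
    of words, and turns those about [desc] into facts about [asc]. *)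
Lemma pe_rev x y : pe x y -> pe (rev x) (rev y).
Proof.
elim=> [|i v w _ IH|i j v w z ij _ IHv _ IHw|i j v w z ij _ IHv _ IHw].
- exact: pe_nil.
- by rewrite !rev_cons -!cats1; apply: pe_catr.
- rewrite !rev_cons -!cats1 in IHv IHw *.
  apply: pe_trans (pe_catr _ IHv) _; apply: pe_trans (pe_sym (pe_catr _ IHw)).
  by rewrite -!catA; apply/pe_catl/pe_swap; rewrite far_sym.
- rewrite !rev_cons -!cats1 in IHv IHw *.
  apply: pe_trans (pe_catr _ IHv) _; apply: pe_trans (pe_sym (pe_catr _ IHw)).
  by rewrite -!catA; apply/pe_catl/pe_braid.
Qed.

Lemma pe_all (P : pred nat) x y : pe x y -> all P x = all P y.
Proof.
elim=> //= [i v w _ -> //|i j v w z _ _ -> _ ->|i j v w z _ _ -> _ ->] /=;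
  by case: (P i) (P j) => [] [].
Qed.

(* [desc k] is [sigma_(k-1) ... sigma_0], and [half_twist k] is the half twist
   on [k] strands. *)
Fixpoint desc k : seq nat := if k is k'.+1 then k' :: desc k' else [::].
Fixpoint half_twist k : seq nat :=
  if k is k'.+1 then half_twist k' ++ desc k' else [::].

Lemma desc_lt k : all (gtn k) (desc k).
Proof.
elim: k => //= k IH; rewrite ltnS leqnn /=.
by apply: sub_all IH => i /=; lia.
Qed.

Lemma half_lt k : all (fun i => i.+1 < k) (half_twist k).
Proof.
elim: k => //= k IH; rewrite all_cat; apply/andP; split.
  by apply: sub_all IH => i /=; lia.
by apply: sub_all (desc_lt k) => i /=; lia.
Qed.

Lemma size_desc k : size (desc k) = k.
Proof. by elim: k => //= k ->. Qed.

Lemma size_half k : (size (half_twist k)).*2 = k * k.-1.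
Proof.
elim: k => //= k IH; rewrite size_cat size_desc doubleD IH; case: k {IH} => //=.
by move=> k; lia.
Qed.

Lemma pe_commute i u : all (far i) u -> forall t, pe (i :: u ++ t) (u ++ i :: t).
Proof.
elim: u => [|j u IH] //= /andP[ij iu] t.
by apply: pe_trans (pe_swap _ ij) (pe_cons _ (IH iu t)).
Qed.

Lemma far_desc k i : k < i -> all (far i) (desc k).
Proof. by move=> ki; apply: sub_all (desc_lt k) => j /=; far_lia. Qed.

Lemma far_half k i : k <= i -> all (far i) (half_twist k).
Proof. by move=> ki; apply: sub_all (half_lt k) => j /=; far_lia. Qed.

Lemma pe_desc_shift k i t : i.+1 < k ->
  pe (desc k ++ i.+1 :: t) (i :: desc k ++ t).
Proof.
elim: k t => // k IH t; rewrite ltnS leq_eqVlt => /orP[/eqP ki|ik].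
  case: k ki {IH} => // k [->]; rewrite /=.
  apply: (@pe_trans _ [:: k.+1, k, k.+1 & desc k ++ t]).
    by do 2!apply: pe_cons; apply/pe_sym/pe_commute/far_desc.
  by apply: pe_braid; far_lia.
rewrite /=; apply: pe_trans (pe_cons _ (IH t ik)) _.
by apply: pe_swap; far_lia.
Qed.

Lemma pe_desc_desc k t :
  pe (desc k ++ desc k.+1 ++ t) (desc k.+1 ++ map succn (desc k) ++ t).
Proof.
have H u : all (gtn k) u -> forall t', 
    pe (desc k.+1 ++ map succn u ++ t') (u ++ desc k.+1 ++ t').
  elim: u => //= i u IH /andP[ik uk] t'.
  apply: pe_trans (@pe_desc_shift k.+1 i _ _) _; first by lia.
  by apply/pe_cons/IH.
exact/pe_sym/H/desc_lt.
Qed.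

Lemma map_desc k : map succn (desc k) ++ [:: 0] = desc k.+1.
Proof. by elim: k => //= k <-. Qed.

(** The letter [0] is the one that a single [desc] cannot shift down; two consecutive factors of the
    half twist absorb it together. This is the base case of [pe_half_shift]. *)
Lemma pe_descS_descS k t :
  pe (desc k ++ desc k.+1 ++ 0 :: t) (desc k.+1 ++ desc k.+1 ++ t).
Proof.
apply: pe_trans (pe_desc_desc _ _) _.
by rewrite -[0 :: t]cat1s (catA (map _ _)) map_desc.
Qed.

Definition flip k i := k.-2 - i.

Lemma pe_half_shift k i t : i.+1 < k ->
  pe (half_twist k ++ i :: t) (flip k i :: half_twist k ++ t).
Proof.
elim: k i t => // k IH [|i] t ik.
  case: k IH ik => // k IH _.
  rewrite /flip subn0 -[half_twist _]/((half_twist k ++ desc k) ++ desc k.+1) -!catA.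
  apply: pe_trans (pe_catl _ (pe_descS_descS _ _)) _.
  apply: pe_sym; apply: pe_trans (pe_commute (far_half (leqnn k)) _) _.
  by apply: pe_catl; rewrite /=.
rewrite -[half_twist _]/(half_twist k ++ desc k) -!catA.
apply: pe_trans (pe_catl _ (@pe_desc_shift k i _ _)) _ => //.
have -> : flip k.+1 i.+1 = flip k i by rewrite /flip; lia.
by apply: IH.
Qed.

Lemma pe_far_dvd i u y z : all (far i) u -> pe (u ++ y) (i :: z) ->
  exists2 y', pe y (i :: y') & pe z (u ++ y').
Proof.
elim: u y z => [|j u IH] y z /=; first by move=> _ yz; exists z.
case/andP=> ij iu; rewrite far_sym in ij.
case/(pe_far_inv ij) => v /(IH _ _ iu)[y' yy' vy'] zv.
by exists y' => //; apply: pe_trans zv (pe_cons _ vy').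
Qed.

(** In other words [desc k ++ desc k.+1] is the least common multiple of [desc k] and the letter
    [k]. *)
Lemma pe_desc_lcm k y z : pe (desc k ++ y) (k :: z) ->
  exists y', pe y (desc k.+1 ++ y').
Proof.
elim: k y z => [|k IH] y z; first by exists z.
have kk : adj k k.+1 by far_lia.
case/(pe_adj_inv kk) => u yu _.
have [y3 yy3 ky3] := pe_far_dvd (far_desc (ltnSn k)) yu.
have [y' y3y'] := IH _ _ (pe_sym ky3).
by exists y'; apply: pe_trans yy3 _; apply: pe_cons.
Qed.

(** Write [half_twist k.+2] as [half_twist k ++ desc k ++ desc k.+1]. The letter [k] is far from the
    first block, so divisibility by [k] concerns what follows it, and the least common multiple of
    [desc k] and [k] supplies the last block. *)
Lemma half_dvd k x : (forall i, i.+1 < k -> exists z, pe x (i :: z)) ->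
  exists y, pe x (half_twist k ++ y).
Proof.
elim: k => [|k IH] dvd_x; first by exists x.
have [|y xy] := IH; first by move=> i ik; apply: dvd_x; apply: ltnW.
case: k {IH} dvd_x xy => [|k] dvd_x xy; first by exists y.
have [z xz] := dvd_x k (ltnSn _).
have := pe_trans (pe_sym xy) xz.
rewrite -[half_twist _]/(half_twist k ++ desc k) -catA.
case/(pe_far_dvd (far_half (leqnn k))) => y1 /pe_desc_lcm[y2 yy2] _.
exists y2; apply: pe_trans xy _.
rewrite -[half_twist k.+2]/(half_twist k.+1 ++ desc k.+1) -catA.
exact: pe_catl.
Qed.

(** * Quasicentral positive braids and the full twist *)

Definition wpow (u : seq nat) m : seq nat := flatten (nseq m u).

Lemma wpowS u m : wpow u m.+1 = u ++ wpow u m. Proof. by []. Qed.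

Lemma wpowD u a b : wpow u (a + b) = wpow u a ++ wpow u b.
Proof. by rewrite /wpow nseqD flatten_cat. Qed.

Lemma size_wpow u m : size (wpow u m) = m * size u.
Proof. by elim: m => // m IH; rewrite wpowS size_cat IH mulSn. Qed.

(** Allowing a twist [tau] makes the property survive division by the half twist, which permutes the
    generators by [flip]. *)
Definition quasicentral n (tau : nat -> nat) (x : seq nat) : Prop :=
  forall i, i.+1 < n -> pe (i :: x) (x ++ [:: tau i]).

(** Since [j x = x tau(j)] begins with [i] as well as with [j], inversion gives [x = i j Z], hence
    [y = j Z]. On the other hand [i x = x tau(i) = i y tau(i)] gives [x = y tau(i)], which therefore
    begins with [j]. *)
Lemma quasicentral_dvd_adj n tau x i j y : quasicentral n tau x ->
  i.+1 < n -> j.+1 < n -> adj i j -> pe x (i :: y) -> exists z, pe x (j :: z).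
Proof.
move=> qx ni nj ij xy; rewrite adj_sym in ij.
have [Z xZ _] := pe_adj_inv ij (pe_trans (qx _ nj) (pe_catr _ xy)).
have yZ := pe_cancel (pe_trans (pe_sym xy) xZ).
have xy' := pe_cancel (pe_trans (qx _ ni) (pe_catr _ xy)).
by exists (Z ++ [:: tau i]); apply: pe_trans xy' (pe_catr _ yZ).
Qed.

Lemma quasicentral_dvd n tau x i y : quasicentral n tau x -> i.+1 < n ->
  pe x (i :: y) -> forall j, j.+1 < n -> exists z, pe x (j :: z).
Proof.
move=> qx ni xy.
have down d : exists z, pe x (i - d :: z).
  elim: d => [|d [z xz]]; first by rewrite subn0; exists y.
  have [id|id] := leqP i d; first by rewrite (_ : i - d.+1 = i - d); [exists z|lia].
  by apply: quasicentral_dvd_adj qx _ _ _ xz; far_lia.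
have up d : i + d < n.-1 -> exists z, pe x (i + d :: z).
  elim: d => [|d IH] nd; first by rewrite addn0; exists y.
  have [|z xz] := IH; first by lia.
  by apply: quasicentral_dvd_adj qx _ _ _ xz; far_lia.
move=> j nj; have [ij|ij] := leqP i j.
  by rewrite -(subnKC ij); apply: up; lia.
by have := down (i - j); rewrite subKn // ltnW.
Qed.

(** A nonempty quasicentral word is divisible by one generator, hence by the half twist; the
    quotient is shorter and quasicentral for [tau \o flip n]. *)
Lemma quasicentral_half_power n tau x : quasicentral n tau x ->
  all (fun i => i.+1 < n) x -> exists m, pe x (wpow (half_twist n) m).
Proof.
have [N] := ubnP (size x); elim: N x tau => // N IH x tau sx qx lx.
case: x => [|i x] in sx qx lx *; first by exists 0; apply: pe_nil.
have ni : i.+1 < n by case/andP: lx.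
have [y xy] := half_dvd (quasicentral_dvd qx ni (pe_refl _)).
have [|||m ym] := IH y (tau \o flip n).
- have /= := pe_size xy; rewrite size_cat.
  have := size_half n; move: ni sx => /=; case: (n) => [|[|n']] //=; lia.
- move=> j nj; apply: (@pe_catI (half_twist n)).
  apply: pe_trans (pe_half_shift _ nj) _.
  have nj' : (flip n j).+1 < n by rewrite /flip; lia.
  apply: pe_trans (pe_cons _ (pe_sym xy)) _.
  by apply: pe_trans (qx _ nj') _; rewrite catA; apply: pe_catr.
- by move: lx; rewrite (pe_all _ xy) all_cat => /andP[].
by exists m.+1; apply: pe_trans xy _; apply: pe_catl.
Qed.

(* [asc k = sigma_0 ... sigma_(k-1)]; with [k = n - 1] its [n]-th power is the
   full twist on [n] strands. *)
Definition asc k : seq nat := iota 0 k.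

Lemma rev_desc k : rev (desc k) = asc k.
Proof. by elim: k => //= k IH; rewrite rev_cons IH -cats1 /asc -addn1 iotaD. Qed.

Lemma asc_shift k i t : i.+1 < k -> pe (i.+1 :: asc k ++ t) (asc k ++ i :: t).
Proof.
move=> ik; have := pe_rev (pe_desc_shift [::] ik).
rewrite cats0 rev_cat !rev_cons rev_desc -!cats1 => H.
by have := pe_catr t H; rewrite /= -catA.
Qed.

Lemma asc_asc k t :
  pe (0 :: asc k.+1 ++ asc k.+1 ++ t) (asc k.+1 ++ asc k.+1 ++ k :: t).
Proof.
have := pe_rev (pe_cons k (pe_descS_descS k [::])).
rewrite -cat_cons -[k :: desc k]/(desc k.+1) cats0 rev_cons !rev_cat !rev_desc.
rewrite -cats1 => H; have := pe_catr t H.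
by rewrite rev_cons -cats1 /= -!catA.
Qed.

Lemma wpow_asc_shift k j i t : i + j <= k ->
  pe (wpow (asc k.+1) j ++ i :: t) (i + j :: wpow (asc k.+1) j ++ t).
Proof.
elim: j i t => [|j IH] i t ijk; first by rewrite addn0.
rewrite wpowS -!catA; apply: pe_trans (pe_catl _ (IH _ _ _)) _; first by lia.
by apply: pe_sym; rewrite addnS; apply: asc_shift; lia.
Qed.

Definition full_twist n := wpow (asc n.-1) n.

(** With [d = asc n.-1] and [k = n - 2], split [d^n] as [d^i d^2 d^(k-i)]. A letter moving left is
    raised from [i] to [k] by the last block, sent from [k] to [0] by [d^2], and raised back to [i]
    by the first. *)
Lemma full_twist_central n i t : i.+1 < n ->
  pe (full_twist n ++ i :: t) (i :: full_twist n ++ t).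
Proof.
case: n => [|[|k]] // ik; set d := asc k.+1.
have -> : full_twist k.+2 = wpow d (i + (2 + (k - i))).
  by rewrite /full_twist; congr wpow; lia.
rewrite !wpowD -!catA cat0s; have ki : i + (k - i) = k by lia.
have H := @wpow_asc_shift k (k - i) i t; rewrite ki in H.
apply: pe_trans (pe_catl _ (pe_catl _ (pe_catl _ (H (leqnn k))))) _.
apply: pe_trans (pe_catl _ (pe_sym (asc_asc _ _))) _.
by apply: (@wpow_asc_shift k i 0).
Qed.

Lemma full_twist_comm n u t : all (fun i => i.+1 < n) u ->
  pe (full_twist n ++ u ++ t) (u ++ full_twist n ++ t).
Proof.
elim: u t => //= i u IH t /andP[ni /IH{}IH].
by apply: pe_trans (full_twist_central _ ni) _; apply: pe_cons.
Qed.

(** The complement of [sigma_i] in the full twist: the leading [0] of one factor [asc n.-1] is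
    removed, since pulling it left across [i] such factors turns it into the letter [i]. *)
Definition twist_quo n i :=
  wpow (asc n.-1) i ++ behead (asc n.-1) ++ wpow (asc n.-1) (n - i.+1).

Lemma twist_quoE n i : i.+1 < n -> pe (i :: twist_quo n i) (full_twist n).
Proof.
case: n => [|[|k]] // ik; rewrite /twist_quo /full_twist.
have -> : wpow (asc k.+2.-1) k.+2 = wpow (asc k.+1) i ++ 0 ::
     behead (asc k.+1) ++ wpow (asc k.+1) (k.+2 - i.+1).
  rewrite -cat_cons -[0 :: _]/(asc k.+1) -wpowS -wpowD; congr wpow; lia.
by apply: pe_sym; apply: (@wpow_asc_shift k i 0); lia.
Qed.

Lemma all_wpow (P : pred nat) u m : all P u -> all P (wpow u m).
Proof. by move=> Pu; elim: m => //= m IH; rewrite wpowS all_cat Pu. Qed.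

Lemma asc_lt n : all (fun i => i.+1 < n) (asc n.-1).
Proof. by apply/allP => i; rewrite mem_iota; lia. Qed.

Lemma full_twist_lt n : all (fun i => i.+1 < n) (full_twist n).
Proof. exact/all_wpow/asc_lt. Qed.

Lemma twist_quo_lt n i : all (fun i => i.+1 < n) (twist_quo n i).
Proof.
rewrite /twist_quo !all_cat !(all_wpow _ (asc_lt n)) andbT /=.
by have := asc_lt n; case: (asc n.-1) => //= a l /andP[].
Qed.

Lemma twist_quoEr n i : i.+1 < n ->
  pe (twist_quo n i ++ [:: i]) (full_twist n).
Proof.
move=> ni; apply: (@pe_catI [:: i]); rewrite catA.
apply: pe_trans (pe_catr _ (twist_quoE ni)) _.
by have := full_twist_central [::] ni; rewrite cats0.
Qed.

(** Centrality already makes the full twist a power of the half twist; comparing lengths gives the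
    exponent. *)
Lemma full_twist_half n : 1 < n -> pe (full_twist n) (half_twist n ++ half_twist n).
Proof.
move=> n2.
have [|m Hm] := @quasicentral_half_power n id (full_twist n) _ (full_twist_lt n).
  by move=> i ni; apply: pe_sym; have := full_twist_central [::] ni; rewrite cats0.
suff m2 : m = 2 by move: Hm; rewrite m2 /wpow /= cats0.
have := size_half n; have := pe_size Hm; rewrite !size_wpow size_iota.
by case: (n) n2 => [|[|k]] // _; set h := size _; nia.
Qed.

(** * The centre of the braid group *)

Section GroupOfFractions.
Variable n : nat.
Implicit Types (u : seq nat) (w : braid_word n).

(** [insub] drops the letters that are not indices of generators. Dropping [j] would turn
    [i j i = j i j] into [i i = i], whence the range hypotheses on words in what follows. *)
Definition bword u : braid_word n := [seq (i, false) | i <- pmap insub u].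

(* A braid word [w] represents [numer w] times the full twist to the power
   [- negs w]. *)
Definition negs w : nat := count snd w.
Definition numer w : seq nat :=
  flatten [seq (let i : nat := x.1 in if x.2 then twist_quo n i else [:: i])
             | x : 'I_n.-1 * bool <- w].

Lemma bword_cat u v : bword (u ++ v) = bword u ++ bword v.
Proof. by rewrite /bword pmap_cat map_cat. Qed.

Lemma bword_cons i u (ni : (i < n.-1)%N) :
  bword (i :: u) = (Ordinal ni, false) :: bword u.
Proof. by rewrite /bword /= insubT. Qed.

Lemma negs_cat v w : negs (v ++ w) = (negs v + negs w)%N.
Proof. exact: count_cat. Qed.

Lemma numer_cat v w : numer (v ++ w) = numer v ++ numer w.
Proof. by rewrite /numer map_cat flatten_cat. Qed.

Lemma numer_lt w : all (fun i => i.+1 < n)%N (numer w).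
Proof.
elim: w => //= -[i b] w IH; rewrite /numer /= all_cat [X in _ && X]IH andbT.
by case: b => /=; [exact: twist_quo_lt | have := ltn_ord i; lia].
Qed.

Lemma wpow_twist_comm m u t : all (fun i => i.+1 < n)%N u ->
  pe (wpow (full_twist n) m ++ u ++ t) (u ++ wpow (full_twist n) m ++ t).
Proof.
move=> lu; elim: m t => //= m IH t; rewrite wpowS -!catA.
exact: pe_trans (pe_catl _ (IH _)) (full_twist_comm _ lu).
Qed.

(** Fractions are compared by cross-multiplication, and transitivity of this comparison is
    cancellation in the monoid. For words without inverse letters it says that the positive monoid
    embeds in the braid group. *)
Lemma numer_rel v w : braid_rel v w ->
  pe (wpow (full_twist n) (negs w) ++ numer v)
     (wpow (full_twist n) (negs v) ++ numer w).
Proof.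
set T := full_twist n.
have lT a : all (fun i => i.+1 < n)%N (wpow T a).
  exact/all_wpow/full_twist_lt.
have TT a b t : wpow T a ++ wpow T b ++ t = wpow T b ++ wpow T a ++ t.
  by rewrite !catA -!wpowD addnC.
elim=> {v w} [w|v w _ /pe_sym //|u v w _ uv _ vw|v v' w w' _ vv' _ ww'
  |i b|i j ij|i j ij].
- exact: pe_refl.
- apply: (@pe_catI (wpow T (negs v))); rewrite TT.
  apply: pe_trans (pe_catl _ uv) _; rewrite TT; apply: pe_trans (pe_catl _ vw) _.
  by rewrite TT.
- rewrite !negs_cat !numer_cat !wpowD -!catA.
  apply: pe_trans (pe_catl _ (wpow_twist_comm _ _ (numer_lt _))) _.
  apply: pe_trans (pe_catl _ (pe_catl _ ww')) _.
  rewrite catA; apply: pe_trans (pe_catr _ vv') _; rewrite -!catA; apply: pe_catl.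
  exact/pe_sym/wpow_twist_comm/numer_lt.
- have ni : (i.+1 < n)%N by have := ltn_ord i; lia.
  rewrite /numer /negs /wpow; case: b; rewrite /= ?cats0.
    exact: twist_quoEr.
  exact: twist_quoE.
- by apply: (@pe_swap i j [::]); rewrite /far ij.
- by apply: (@pe_braid i j [::]); rewrite /adj ij eqxx.
Qed.

Lemma braid_pi_cat v w :
  \pi_(braid n) (v ++ w) = (\pi_(braid n) v * \pi_(braid n) w)%g.
Proof. exact/esym/braid_mulE. Qed.

Definition pos u : braid n := \pi_(braid n) (bword u).

Lemma pos_cat u v : pos (u ++ v) = (pos u * pos v)%g.
Proof. by rewrite /pos bword_cat braid_pi_cat. Qed.

Lemma pos_cons i u : pos (i :: u) = (pos [:: i] * pos u)%g.
Proof. by rewrite -pos_cat. Qed.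

Lemma pos_artin (i : 'I_n.-1) : pos [:: i : nat] = artin i.
Proof.
rewrite /pos (bword_cons _ (ltn_ord i)) /artin; congr (\pi [:: (_, _)]).
exact: val_inj.
Qed.

Lemma artin_far (i j : 'I_n.-1) : far i j ->
  (artin i * artin j = artin j * artin i)%g.
Proof.
move=> ij; rewrite /artin.
apply: etrans (braid_mulE _ _) _; apply: etrans (esym (braid_mulE _ _)).
by apply/braid_eqP; case/orP: ij => ij; [|apply: braid_sym]; apply: braid_far.
Qed.

Lemma artin_yb (i j : 'I_n.-1) : adj i j ->
  (artin i * (artin j * artin i) = artin j * (artin i * artin j))%g.
Proof.
have E (k l : 'I_n.-1) : (artin k * (artin l * artin k))%g =
    \pi_(braid n) [:: (k, false); (l, false); (k, false)].
  rewrite /artin -[(_ * _)%g]/(braid_mul _ (braid_mul _ _)).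
  by rewrite !braid_mulE.
move=> ij; rewrite !E; apply/braid_eqP.
by case/orP: ij => /eqP ij; [|apply: braid_sym]; apply: braid_yb.
Qed.

Lemma pos_pe u v : pe u v -> all (fun i => i.+1 < n)%N u -> pos u = pos v.
Proof.
have swap a b : (a.+1 < n)%N -> (b.+1 < n)%N -> far a b ->
    (pos [:: a] * pos [:: b] = pos [:: b] * pos [:: a])%g.
  rewrite -!ltn_predRL => na nb.
  rewrite -[a]/(nat_of_ord (Ordinal na)) -[b]/(nat_of_ord (Ordinal nb)).
  by rewrite !pos_artin; apply: artin_far.
have braid a b : (a.+1 < n)%N -> (b.+1 < n)%N -> adj a b ->
    (pos [:: a] * (pos [:: b] * pos [:: a])
     = pos [:: b] * (pos [:: a] * pos [:: b]))%g.
  rewrite -!ltn_predRL => na nb.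
  rewrite -[a]/(nat_of_ord (Ordinal na)) -[b]/(nat_of_ord (Ordinal nb)).
  by rewrite !pos_artin; apply: artin_yb.
elim=> {u v} [|i x y _ IH|i j x y z ij xz IHx yz IHy|i j x y z ij xz IHx yz IHy] //=.
- by case/andP=> ni lx; rewrite pos_cons IH // -pos_cons.
- move=> /= /andP[ni lx]; have := lx; rewrite (pe_all _ xz) => /andP[nj lz].
  have ly : all (fun i => i.+1 < n)%N y by rewrite (pe_all _ yz) /= ni.
  rewrite pos_cons (pos_cons j y) IHx // IHy // (pos_cons j) (pos_cons i z).
  by rewrite !mulgA swap.
- move=> /= /andP[ni lx]; have := lx; rewrite (pe_all _ xz) => /and3P[nj _ lz].
  have ly : all (fun i => i.+1 < n)%N y by rewrite (pe_all _ yz) /= ni nj.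
  rewrite pos_cons (pos_cons j y) IHx // IHy //.
  rewrite !(pos_cons i (_ :: _)) !(pos_cons j (_ :: _)) (pos_cons i z) (pos_cons j z).
  have := congr1 (fun t => t * pos z)%g (braid _ _ ni nj ij).
  by rewrite -!mulgA.
Qed.

Lemma pos_wpow u m : pos (wpow u m) = (pos u ^+ m)%g.
Proof. by elim: m => [|m IH] //; rewrite wpowS pos_cat IH expgS. Qed.

Lemma pos_twist_comm z : commute (pos (full_twist n)) z.
Proof.
rewrite -(reprK z); elim: (repr z) => [|[i b] w IH]; first exact: commute1.
rewrite -cat1s braid_pi_cat; apply: commuteM IH.
have ci : commute (pos (full_twist n)) (artin i).
  rewrite /commute -pos_artin -!pos_cat; apply: pos_pe.
    rewrite -[RHS in pe _ RHS](cats0 _) -catA.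
    by apply: full_twist_central; have := ltn_ord i; lia.
  by rewrite all_cat full_twist_lt /=; have := ltn_ord i; lia.
case: b => //; suff -> : \pi_(braid n) [:: (i, true)] = ((artin i)^-1)%g.
  exact: commuteV.
exact/esym/braid_invE.
Qed.

Lemma pos_numer w :
  pos (numer w) = (\pi_(braid n) w * pos (full_twist n) ^+ negs w)%g.
Proof.
elim: w => [|[i b] w IH]; first by rewrite mulg1.
rewrite -cat1s numer_cat negs_cat pos_cat IH braid_pi_cat.
have -> : pos (numer [:: (i, b)]) =
    (\pi_(braid n) [:: (i, b)] * pos (full_twist n) ^+ negs [:: (i, b)])%g.
  rewrite /numer /negs /= cats0; case: b => /=; last first.
    by rewrite mulg1 pos_artin.
  have -> : \pi_(braid n) [:: (i, true)] = ((artin i)^-1)%g.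
    exact/esym/braid_invE.
  have ni : (i.+1 < n)%N by have := ltn_ord i; lia.
  rewrite addn0 expg1 -(pos_pe (twist_quoE ni)) /=; last by rewrite ni twist_quo_lt.
  by rewrite pos_cons pos_artin mulKg.
have E a : (pos (full_twist n) ^+ a * \pi_(braid n) w
            = \pi_(braid n) w * pos (full_twist n) ^+ a)%g.
  exact/esym/commuteX/commute_sym/pos_twist_comm.
rewrite (expgnDr _ (negs [:: (i, b)]) (negs w)) mulgA.
by rewrite -(mulgA _ _ (\pi_(braid n) w)) E !mulgA.
Qed.

(** The words for [sigma z] and [z sigma] contain equally many inverse letters, so the denominators
    cancel and the numerator of [z] is quasicentral with trivial twist. *)
Lemma central_braid z : (1 < n)%N -> central z -> exists k m : nat,
  (z * pos (full_twist n) ^+ k)%g = (pos (half_twist n) ^+ m)%g.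
Proof.
move=> n2 cz; pose w := repr z; exists (negs w).
have [||m xm] := @quasicentral_half_power n id (numer w); last 1 first.
- exists m; rewrite -(pos_wpow (half_twist n)) -(pos_pe xm (numer_lt w)) pos_numer.
  by rewrite /w reprK.
- move=> i; rewrite -ltn_predRL => ni.
  pose o := Ordinal ni.
  have : braid_rel ([:: (o, false)] ++ w) (w ++ [:: (o, false)]).
    by apply/braid_eqP; rewrite -!braid_mulE /w reprK; apply/esym/cz.
  move/numer_rel; rewrite !negs_cat !numer_cat /= add0n addn0.
  exact: pe_catI.
- exact: numer_lt.
Qed.

Lemma pos_half_sq : (1 < n)%N -> (pos (half_twist n) ^+ 2)%g = pos (full_twist n).
Proof.
by move=> n2; rewrite expg2 -pos_cat (pos_pe (full_twist_half n2)) ?full_twist_lt.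
Qed.

End GroupOfFractions.

(** * Coordinates of tensors *)

Local Open Scope ring_scope.

Section QuantumModel.
Variables (C : fieldType) (q s : C) (r : nat).
Local Notation fn := (seq nat -> C).
Implicit Types (phi psi : fn) (p t : seq nat).

Definition brace (x : nat) : C := q ^+ x - q ^- x.
Definition bint (x : nat) : C := brace x / brace 1.
Definition bfact (m : nat) : C := \prod_(1 <= k < m.+1) bint k.
Definition wt (k : nat) : C := s * q ^- (2 * k).
Definition wts p : C := \prod_(k <- p) wt k.

(* [phi [:: k1; ...; kn]] is the coefficient of [u_k1 (x) ... (x) u_kn] in a
   tensor, and [fE], [fF], [fR i] give the coefficients of its images under
   [E], [F] and the [R]-matrix at the strands [i], [i + 1]. *)
Fixpoint fE phi p : C :=
  if p is k :: t then phi (k.+1 :: t) * wts t + fE (fun u => phi (k :: u)) t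
  else 0.

Fixpoint fF phi p : C :=
  if p is k :: t then bint k ^+ 2 * phi (k.-1 :: t)
                      + (wt k)^-1 * fF (fun u => phi (k :: u)) t
  else 0.

(** The R-matrix indexed by its output [u_b (x) u_c]: the input is [u_i (x) u_j] with [i = c + a],
    [j = b - a]. The binomial times the product of braces equals [{1}^a ([b]!/[b-a]!)^2 / [a]!], the
    exponent [2(i-a)(j+a)] becomes [2cb], independent of [a], and the limits of summation become
    [a <= b < r]. *)
Definition rcoef (b a : nat) : C :=
  q ^+ ((a * a.-1) %/ 2) * brace 1 ^+ a / bfact a
  * (bfact b / bfact (b - a)) ^+ 2.
Definition rdiag (b c : nat) : C := s ^- (b + c) * q ^+ (2 * c * b).

Definition fR0 phi p : C :=
  if p is [:: b, c & t] then
    if (b < r)%N then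
      rdiag b c * \sum_(0 <= a < b.+1) rcoef b a * phi [:: (c + a)%N, (b - a)%N & t]
    else 0
  else 0.

Fixpoint fR (i : nat) phi p : C :=
  if i is j.+1 then if p is k :: t then fR j (fun u => phi (k :: u)) t else 0
  else fR0 phi p.

(** What the computations use of the root of unity; the field stays arbitrary. *)
Record steinberg_param : Prop := SteinbergParam {
  param_q_neq0 : q != 0;
  param_sE : s = - q^-1;
  param_brace1_neq0 : brace 1 != 0;
  param_r_gt0 : (0 < r)%N;
  param_bint_r : bint r = 0;
  param_bint_neq0 : forall m, (0 < m < r)%N -> bint m != 0 }.

Hypothesis par : steinberg_param.
Let q_neq0 : q != 0. Proof. by case: par. Qed.
Let sE : s = - q^-1. Proof. by case: par. Qed.
Let brace1_neq0 : brace 1 != 0. Proof. by case: par. Qed.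
Let r_gt0 : (0 < r)%N. Proof. by case: par. Qed.
Let bint_r : bint r = 0. Proof. by case: par. Qed.
Let bint_neq0 m : (0 < m < r)%N -> bint m != 0.
Proof. by case: par => ? ? ? ? ?; apply. Qed.

Lemma s_neq0 : s != 0.
Proof. by rewrite sE oppr_eq0 invr_eq0. Qed.

Lemma wt_neq0 k : wt k != 0.
Proof. by rewrite mulf_neq0 ?s_neq0 // invr_eq0 expf_neq0. Qed.

Lemma wts_cons k t : wts (k :: t) = wt k * wts t.
Proof. by rewrite /wts big_cons. Qed.

Lemma wts_cat p t : wts (p ++ t) = wts p * wts t.
Proof. by rewrite /wts big_cat. Qed.

Lemma wts_neq0 p : wts p != 0.
Proof.
elim: p => [|k p IH]; first by rewrite /wts big_nil oner_eq0.
by rewrite wts_cons mulf_neq0 ?wt_neq0.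
Qed.

Lemma wtsE p : wts p = s ^+ size p * q ^- (2 * sumn p).
Proof.
elim: p => [|k p IH]; first by rewrite /wts big_nil muln0 expr0 invr1 mulr1.
by rewrite wts_cons IH /wt /= exprS mulnDr exprD invfM; ring.
Qed.

Lemma wtS k : wt k.+1 = wt k * q ^- 2.
Proof. by rewrite /wt mulnS exprD invfM; ring. Qed.

Lemma bint0 : bint 0 = 0.
Proof. by rewrite /bint /brace expr0 invr1 subrr mul0r. Qed.

(** As [[r - k] = [k]], the coefficients of [F] are squares, and this is the relation
    [E F - F E = (K - K^-1) / {1}] on the basis vector [u_k]. *)
Lemma bint_sqS k :
  brace 1 * (bint k.+1 ^+ 2 - bint k ^+ 2) = wt k - (wt k)^-1.
Proof.
have := brace1_neq0; rewrite /bint /wt sE /brace expr1 (exprS q k) mul2n -addnn exprD.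
set u := q ^+ k; have u0 : u != 0 by rewrite expf_neq0.
move=> b0; have b1 : q * q - 1 != 0.
  apply: contra b0 => /eqP e; rewrite -(mulfK q_neq0 (q - q^-1)).
  by rewrite mulrBl mulVf // e mul0r.
by field; rewrite u0 q_neq0 oppr_eq0 oner_eq0 b1.
Qed.

Lemma bint_sqD c a :
  (bint (c + a).+1 ^+ 2 - bint c ^+ 2) * (brace 1 * q ^+ a)
  = bint a.+1 * (wt c - (wt (c + a))^-1).
Proof.
have := brace1_neq0; rewrite /bint /wt sE /brace expr1 !(exprS q (_ + _)).
rewrite (exprS q a) !mul2n -!addnn !exprD.
set u := q ^+ c; have u0 : u != 0 by rewrite expf_neq0.
set v := q ^+ a; have v0 : v != 0 by rewrite expf_neq0.
move=> b0; have b1 : q * q - 1 != 0.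
  apply: contra b0 => /eqP e; rewrite -(mulfK q_neq0 (q - q^-1)).
  by rewrite mulrBl mulVf // e mul0r.
by field; rewrite u0 v0 q_neq0 oppr_eq0 oner_eq0 b1.
Qed.

Lemma bfactS m : bfact m.+1 = bfact m * bint m.+1.
Proof. by rewrite /bfact big_nat_recr. Qed.

Lemma bfact_neq0 m : (m < r)%N -> bfact m != 0.
Proof.
elim: m => [|m IH] mr; first by rewrite /bfact big_nil oner_eq0.
by rewrite bfactS mulf_neq0 ?bint_neq0 // IH // ltnW.
Qed.

Lemma rcoef0 b : (b < r)%N -> rcoef b 0 = 1.
Proof.
move=> br; rewrite /rcoef subn0 divff ?bfact_neq0 // /bfact big_nil.
by rewrite !expr0 expr1n invr1 !mulr1.
Qed.

Lemma rcoefS b a : (a < b)%N -> (b < r)%N ->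
  bint a.+1 * rcoef b a.+1 = brace 1 * q ^+ a * bint (b - a) ^+ 2 * rcoef b a.
Proof.
move=> ab br; rewrite /rcoef.
have -> : (a.+1 * a.+1.-1 %/ 2 = a * a.-1 %/ 2 + a)%N.
  rewrite -[X in _ = (_ + X)%N](mulnK a (d := 2)) // -divnDr ?dvdn_mull //.
  by congr (_ %/ 2)%N; case: (a) => //= a'; lia.
rewrite exprD exprS bfactS.
have -> : (b - a = (b - a.+1).+1)%N by lia.
rewrite bfactS.
have h1 : bfact a != 0 by apply: bfact_neq0; lia.
have h2 : bint a.+1 != 0 by apply: bint_neq0; lia.
have h3 : bfact (b - a.+1) != 0 by apply: bfact_neq0; lia.
have h4 : bint (b - a.+1).+1 != 0 by apply: bint_neq0; lia.
by field; rewrite h1 h2 h3 h4.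
Qed.

Lemma rcoef_pred b a : (a < b)%N -> (b < r)%N ->
  bint a.+1 * rcoef b a.+1 = brace 1 * q ^+ a * bint b ^+ 2 * rcoef b.-1 a.
Proof.
case: b => // b; rewrite ltnS => ab br; rewrite /rcoef subSS /=.
have -> : (a.+1 * a %/ 2 = a * a.-1 %/ 2 + a)%N.
  rewrite -[X in _ = (_ + X)%N](mulnK a (d := 2)) // -divnDr ?dvdn_mull //.
  by congr (_ %/ 2)%N; case: (a) => //= a'; lia.
rewrite exprD exprS !bfactS.
have h1 : bfact a != 0 by apply: bfact_neq0; lia.
have h2 : bint a.+1 != 0 by apply: bint_neq0; lia.
have h3 : bfact (b - a) != 0 by apply: bfact_neq0; lia.
by field; rewrite h1 h2 h3.
Qed.

Lemma rdiagSr b c : rdiag b c.+1 = rdiag b c * (wt b)^-1.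
Proof.
rewrite /rdiag /wt addnS exprS mulnS mulnDl (exprD q) !invfM invrK; ring.
Qed.

Lemma rdiagSl b c : rdiag b.+1 c = rdiag b c * (wt c)^-1.
Proof.
rewrite /rdiag /wt addSn exprS mulnS (exprD q) !invfM invrK; ring.
Qed.

Lemma fE_lin x y phi psi p :
  fE (fun t => x * phi t + y * psi t) p = x * fE phi p + y * fE psi p.
Proof.
by elim: p phi psi => [|k p IH] phi psi /=; [rewrite !mulr0 addr0 | rewrite IH; ring].
Qed.

Lemma fF_lin x y phi psi p :
  fF (fun t => x * phi t + y * psi t) p = x * fF phi p + y * fF psi p.
Proof.
by elim: p phi psi => [|k p IH] phi psi /=; [rewrite !mulr0 addr0 | rewrite IH; ring].
Qed.

Lemma fR_lin i x y phi psi p :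
  fR i (fun t => x * phi t + y * psi t) p = x * fR i phi p + y * fR i psi p.
Proof.
elim: i p phi psi => [|i IH] p phi psi /=; last first.
  by case: p => [|k p]; [rewrite !mulr0 addr0 | rewrite IH].
case: p => [|b [|c t]]; rewrite /fR0 ?mulr0 ?addr0 //.
case: ifP => _; last by rewrite !mulr0 addr0.
rewrite (mulrCA x) (mulrCA y) -mulrDr; congr (_ * _).
by rewrite !mulr_sumr -big_split; apply: eq_bigr => a _ /=; ring.
Qed.

(** This form records the grading as well: only words of the same length and of weight one higher
    contribute. With linearity it yields all statements about supports. *)
Lemma fE_ext phi psi p :
  (forall t, size t = size p -> sumn t = (sumn p).+1 -> phi t = psi t) ->
  fE phi p = fE psi p.
Proof.
elim: p phi psi => //= k p IH phi psi e; rewrite e ?addSn //.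
congr (_ + _); apply: IH => t st et; apply: e => /=; rewrite ?st //.
by rewrite et addnS.
Qed.

Lemma fF_ext phi psi p :
  (forall t, size t = size p -> (sumn t).+1 = sumn p -> phi t = psi t) ->
  fF phi p = fF psi p.
Proof.
elim: p phi psi => //= k p IH phi psi e.
congr (_ + _ * _).
  (* At [k = 0] the truncated predecessor does not lower the weight, but the coefficient [[0]^2]
     vanishes. *)
  by case: k e => [|k] e; [rewrite bint0 expr0n !mul0r | rewrite e].
by apply: IH => t st et; apply: e => /=; rewrite ?st // -addnS et.
Qed.

Lemma fR_ext i phi psi p :
  (forall t, size t = size p -> sumn t = sumn p -> phi t = psi t) ->
  fR i phi p = fR i psi p.
Proof.
elim: i p phi psi => [|i IH] p phi psi e /=.
  case: p e => [|b [|c t]] //= e; case: ifP => // br; congr (_ * _).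
  apply: eq_big_nat => a ab; rewrite e //=; lia.
case: p e => //= k p e; apply: IH => t st et; apply: e => /=; lia.
Qed.

Lemma fE0 p : fE (fun=> 0) p = 0.
Proof. by elim: p => //= k p ->; rewrite mul0r add0r. Qed.
Lemma fF0 p : fF (fun=> 0) p = 0.
Proof. by elim: p => //= k p ->; rewrite !mulr0 add0r. Qed.

Lemma lin_sum (L : fn -> C) :
    (forall x y phi psi,
       L (fun t => x * phi t + y * psi t) = x * L phi + y * L psi) ->
  forall (I : Type) (l : seq I) (P : pred I) (c : I -> C) (f : I -> fn),
  L (fun t => \sum_(i <- l | P i) c i * f i t) = \sum_(i <- l | P i) c i * L (f i).
Proof.
move=> Llin I l P c f; have L0 : L (fun=> 0) = 0.
  have := Llin 0 0 (fun=> 0) (fun=> 0); rewrite !mul0r addr0 => {2}<-.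
  by congr L; apply/funext => t; rewrite !mul0r addr0.
elim: l => [|i l IH].
  by rewrite big_nil -[RHS]L0; congr L; apply/funext => t; rewrite big_nil.
rewrite big_cons -IH; case: ifP => Pi; last first.
  by congr L; apply/funext => t; rewrite big_cons Pi.
rewrite -[X in _ + X]mul1r -Llin; congr L; apply/funext => t.
by rewrite big_cons Pi mul1r.
Qed.

(** * Commutation of the R-matrix with [F] *)

(** The coefficient identity behind [R F = F R]. After multiplication by [{1} q^a] the recursions
    [rcoefS] and [rcoef_pred] remove the factorials, and [bint_sqD] is what remains. *)
Lemma rcoef_fF b c a : (a < b)%N -> (b < r)%N ->
  rcoef b a.+1 * bint (c + a).+1 ^+ 2 + rcoef b a * (wt (c + a))^-1 * bint (b - a) ^+ 2
  = bint b ^+ 2 * wt c * rcoef b.-1 a + bint c ^+ 2 * rcoef b a.+1.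
Proof.
move=> ab br; have v0 : brace 1 * q ^+ a != 0.
  by rewrite mulf_neq0 ?brace1_neq0 ?expf_neq0.
apply: (mulfI v0); have e1 := rcoefS ab br; have e2 := rcoef_pred ab br.
have e3 := bint_sqD c a; set w := (wt _)^-1 in e3 *.
have -> : brace 1 * q ^+ a *
  (rcoef b a.+1 * bint (c + a).+1 ^+ 2 + rcoef b a * w * bint (b - a) ^+ 2) =
  rcoef b a.+1 * (brace 1 * q ^+ a * bint (c + a).+1 ^+ 2)
   + w * (brace 1 * q ^+ a * bint (b - a) ^+ 2 * rcoef b a) by ring.
have -> : brace 1 * q ^+ a *
  (bint b ^+ 2 * wt c * rcoef b.-1 a + bint c ^+ 2 * rcoef b a.+1) =
  wt c * (brace 1 * q ^+ a * bint b ^+ 2 * rcoef b.-1 a)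
   + brace 1 * q ^+ a * bint c ^+ 2 * rcoef b a.+1 by ring.
rewrite -e1 -e2.
have -> : brace 1 * q ^+ a * bint (c + a).+1 ^+ 2 =
  bint a.+1 * (wt c - w) + brace 1 * q ^+ a * bint c ^+ 2 by rewrite -e3; ring.
ring.
Qed.

Lemma wt_swap b c a : (a <= b)%N -> wt (c + a) * wt (b - a) = wt b * wt c.
Proof.
move=> ab; rewrite /wt -!mulrA; congr (_ * _).
rewrite mulrCA [RHS]mulrCA; congr (_ * _).
by rewrite -!invfM -!exprD; congr (_ ^- _); lia.
Qed.

Lemma fR_fF0 phi p : fR0 (fF phi) p = fF (fR0 phi) p.
Proof.
case: p => [|b [|c t]] //=; first by rewrite !mulr0 addr0.
have [br|rb] := ltnP b r; last first.
  (* Outside the range [b < r] only [b = r] could contribute, through [b.-1], and there the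
     coefficient is [[r]^2 = 0]. *)
  rewrite fF0 !mulr0 addr0 !mulr0 addr0; case: ifP => [br|_]; last by rewrite mulr0.
  by have -> : b = r by [lia]; rewrite bint_r expr0n mul0r.
set G := fun a => fF (fun u => phi [:: (c + a)%N, (b - a)%N & u]) t.
have -> : fF (fun u => rdiag b c * \sum_(0 <= a < b.+1)
      rcoef b a * phi [:: (c + a)%N, (b - a)%N & u]) t =
    rdiag b c * \sum_(0 <= a < b.+1) rcoef b a * G a.
  transitivity (fF (fun u => \sum_(0 <= a < b.+1)
    (rdiag b c * rcoef b a) * phi [:: (c + a)%N, (b - a)%N & u]) t).
    by apply: fF_ext => u _ _; rewrite mulr_sumr; under eq_bigr do rewrite mulrA.
  rewrite (lin_sum (fun x y phi psi => fF_lin x y phi psi t)) mulr_sumr.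
  by under eq_bigr do rewrite -mulrA.
(* Apart from the terms [G a], in which [F] acts on the tail [t], both sides are combinations of the
   values [f a], after shifting the summation index where necessary. *)
pose f a := phi [:: (c + a)%N, (b - a).-1 & t].
have -> : bint b ^+ 2 * (if (b.-1 < r)%N then rdiag b.-1 c * (\sum_(0 <= a < b.-1.+1)
      rcoef b.-1 a * phi [:: (c + a)%N, (b.-1 - a)%N & t]) else 0) =
    rdiag b c * \sum_(0 <= a < b) bint b ^+ 2 * wt c * rcoef b.-1 a * f a.
  case: (b) br @f @G => [|d] dr f _; first by rewrite bint0 expr0n mul0r big_nil mulr0.
  rewrite /= ltnW // rdiagSl -[in RHS]mulrA !mulr_sumr.
  apply: eq_big_nat => a ad; rewrite /f subSn //=; field.
  exact: wt_neq0.
have -> : bint c ^+ 2 * (rdiag b c.-1 * (\sum_(0 <= a < b.+1)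
      rcoef b a * phi [:: (c.-1 + a)%N, (b - a)%N & t])) =
    rdiag b c * wt b * (bint c ^+ 2 * phi [:: c.-1, b & t]
      + \sum_(0 <= a < b) bint c ^+ 2 * rcoef b a.+1 * f a).
  case: (c) @f @G => [|d] f _.
    rewrite bint0 expr0n !mul0r add0r big1 ?mulr0 // => a _; by rewrite !mul0r.
  rewrite rdiagSr mulrVK ?unitfE ?wt_neq0 // mulrCA; congr (_ * _).
  rewrite big_nat_recl //= rcoef0 // addn0 subn0 mul1r mulrDr mulr_sumr.
  congr (_ + _); apply: eq_big_nat => a ab; rewrite /f mulrA addSnnS subnS //.
have -> : \sum_(0 <= a < b.+1) rcoef b a *
    (bint (c + a) ^+ 2 * phi [:: (c + a).-1, (b - a)%N & t]
     + (wt (c + a))^-1 * (bint (b - a) ^+ 2 * f a + (wt (b - a))^-1 * G a)) =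
  \sum_(0 <= a < b.+1) rcoef b a * bint (c + a) ^+ 2 * phi [:: (c + a).-1, (b - a)%N & t]
  + \sum_(0 <= a < b.+1) rcoef b a * (wt (c + a))^-1 * bint (b - a) ^+ 2 * f a
  + (wt b)^-1 * (wt c)^-1 * \sum_(0 <= a < b.+1) rcoef b a * G a.
  rewrite mulr_sumr -!big_split /=; apply: eq_big_nat => a ab.
  rewrite -invfM -(@wt_swap b c a); last by lia.
  by rewrite (invfM (wt _) (wt _)); ring.
rewrite big_nat_recl // rcoef0 // addn0 subn0 mul1r.
rewrite [X in _ + X + _]big_nat_recr //= subnn bint0 expr0n mulr0 mul0r addr0.
have -> : \sum_(0 <= a < b) rcoef b a.+1 * bint (c + a.+1) ^+ 2 *
      phi [:: (c + a.+1).-1, (b - a.+1)%N & t] =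
   \sum_(0 <= a < b) bint b ^+ 2 * wt c * rcoef b.-1 a * f a
   + \sum_(0 <= a < b) bint c ^+ 2 * rcoef b a.+1 * f a
   - \sum_(0 <= a < b) rcoef b a * (wt (c + a))^-1 * bint (b - a) ^+ 2 * f a.
  rewrite -big_split -sumrB /=; apply: eq_big_nat => a ab.
  rewrite -mulrDl -rcoef_fF // addnS subnS /= -/(f a); ring.
field; rewrite wt_neq0 wt_neq0 //.
Qed.

Lemma fR_fF i phi : fR i (fF phi) = fF (fR i phi).
Proof.
apply/funext => p; elim: i p phi => [|i IH] p phi; first exact: fR_fF0.
case: p => [|k t] //=; rewrite -IH -fR_lin; apply: fR_ext => u _ _ //.
Qed.

Definition in_range phi := forall p, ~~ all (gtn r) p -> phi p = 0.
Definition head0 phi := forall k t, (0 < k)%N -> phi (k :: t) = 0.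

Lemma in_range_cons k phi : in_range phi -> in_range (fun t => phi (k :: t)).
Proof. by move=> rp p np; apply: rp => /=; rewrite negb_and np orbT. Qed.

Lemma in_range_head k t phi : in_range phi -> (r <= k)%N -> phi (k :: t) = 0.
Proof. by move=> rp rk; apply: rp => /=; rewrite negb_and -leqNgt rk. Qed.

Lemma in_range_lin x y phi psi : in_range phi -> in_range psi ->
  in_range (fun t => x * phi t + y * psi t).
Proof. by move=> rphi rpsi p np; rewrite rphi // rpsi // !mulr0 addr0. Qed.

Lemma in_range_fE phi : in_range phi -> in_range (fE phi).
Proof.
move=> rp p; elim: p phi rp => //= k p IH phi rp.
have [rk _|kr] /= := leqP r k.
  rewrite (in_range_head _ rp (leqW rk)) mul0r add0r -[RHS](fE0 p).
  by apply: fE_ext => u _ _; apply: in_range_head.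
move=> np; rewrite (IH _ (in_range_cons k rp) np) rp ?mul0r ?addr0 //=.
by rewrite negb_and np orbT.
Qed.

Lemma in_range_fF phi : in_range phi -> in_range (fF phi).
Proof.
move=> rp p; elim: p phi rp => //= k p IH phi rp.
have [rk _|kr] /= := leqP r k.
  have -> : fF (fun u => phi (k :: u)) p = 0.
    rewrite -[RHS](fF0 p).
    by apply: fF_ext => u _ _; apply: in_range_head.
  move: rk; rewrite leq_eqVlt => /orP[/eqP <-|rk].
    by rewrite bint_r expr0n mul0r mulr0 addr0.
  by rewrite in_range_head ?mulr0 ?addr0 //; lia.
move=> np; rewrite (IH _ (in_range_cons k rp) np) rp ?mulr0 ?addr0 //=.
by rewrite negb_and np orbT.
Qed.

Lemma in_range_fR i phi : in_range phi -> in_range (fR i phi).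
Proof.
move=> rp p; elim: i p phi rp => [|i IH] p phi rp; last first.
  case: p => //= k t; have [rk _|kr np] /= := leqP r k; last first.
    by apply: IH => //; apply: in_range_cons.
  transitivity (fR i (fun u => 0 * phi u + 0 * phi u) t); last first.
    by rewrite fR_lin !mul0r addr0.
  by apply: fR_ext => u _ _; rewrite in_range_head // !mul0r addr0.
case: p => [|b [|c t]] //=; case: ifP => //= br np; rewrite big1_seq ?mulr0 //.
move=> a _; rewrite rp ?mulr0 //=; move: np; case: (all _ t); rewrite ?andbF //.
by rewrite !andbT /= => cr; rewrite negb_and; apply/orP; left; lia.
Qed.

(* [V] is generated by [u_0] under [F], so the vectors whose first tensor factor
   is [u_0] generate the tensor power under the total [F]. *)
Lemma in_range_ind (P : fn -> Prop) :
  (forall phi psi, P phi -> P psi -> P (fun t => phi t + psi t)) ->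
  (forall phi, in_range phi -> P phi -> P (fF phi)) ->
  (forall phi, in_range phi -> head0 phi -> P phi) ->
  forall phi, in_range phi -> P phi.
Proof.
move=> PD PF P0.
have H m : (m < r)%N -> forall phi, in_range phi ->
    (forall k t, (m < k)%N -> phi (k :: t) = 0) -> P phi.
  elim: m => [|m IH] mr phi rp hp; first exact: P0.
  (* The top slice [m.+1], moved down to [m] and divided by the coefficient of [F]: subtracting
     [fF phi'] clears the slice [m.+1] of [phi]. *)
  pose phi' p := if p is k :: t then
      if k == m then phi (m.+1 :: t) / bint m.+1 ^+ 2 else 0 else 0.
  have rp' : in_range phi'.
    move=> [|k t] //=; case: eqP => // -> np; rewrite rp ?mul0r //=.
    by move: np; rewrite !negb_and; case/orP=> [|->]; rewrite ?orbT //; lia.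
  have Pp' : P phi'.
    by apply: IH => //; [exact: ltnW | move=> k t mk; rewrite /phi' gtn_eqF].
  have -> : phi = fun p => (1 * phi p + (-1) * fF phi' p) + fF phi' p.
    by apply/funext => p; ring.
  apply: PD; last exact: PF.
  apply: IH; first exact: ltnW.
    by apply: in_range_lin => //; apply: in_range_fF.
  move=> k t mk; rewrite /= [X in _ + _ * (_ + _ * X)](_ : _ = 0); last first.
    rewrite -[RHS](fF0 t); apply: fF_ext => u _ _; rewrite /phi' gtn_eqF //.
  move: mk; rewrite leq_eqVlt => /orP[/eqP <-|mk] /=.
    rewrite eqxx; by field; rewrite wt_neq0 bint_neq0.
  rewrite hp // gtn_eqF; last by lia.
  by rewrite !mulr0 addr0 mulr0 addr0.
move=> phi rp; apply: (H r.-1) => // [|k t rk]; first by lia.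
by apply: in_range_head => //; lia.
Qed.

Lemma fE_add phi psi : fE (fun t => phi t + psi t) = fun t => fE phi t + fE psi t.
Proof.
apply/funext => p; rewrite -[fE phi p]mul1r -[fE psi p]mul1r -fE_lin.
by apply: fE_ext => t _ _; rewrite !mul1r.
Qed.

Lemma fF_add phi psi : fF (fun t => phi t + psi t) = fun t => fF phi t + fF psi t.
Proof.
apply/funext => p; rewrite -[fF phi p]mul1r -[fF psi p]mul1r -fF_lin.
by apply: fF_ext => t _ _; rewrite !mul1r.
Qed.

Lemma fR_add i phi psi : 
  fR i (fun t => phi t + psi t) = fun t => fR i phi t + fR i psi t.
Proof.
apply/funext => p; rewrite -[fR _ phi p]mul1r -[fR _ psi p]mul1r -fR_lin.
by apply: fR_ext => t _ _; rewrite !mul1r.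
Qed.

Lemma fF_scale x phi p : fF (fun t => x * phi t) p = x * fF phi p.
Proof.
rewrite -[RHS]addr0 -(mul0r (fF phi p)) -fF_lin.
by apply: fF_ext => t _ _; rewrite mul0r addr0.
Qed.

Lemma fE_scale x phi p : fE (fun t => x * phi t) p = x * fE phi p.
Proof.
rewrite -[RHS]addr0 -(mul0r (fE phi p)) -fE_lin.
by apply: fE_ext => t _ _; rewrite mul0r addr0.
Qed.

Lemma fR_scale i x phi p : fR i (fun t => x * phi t) p = x * fR i phi p.
Proof.
rewrite -[RHS]addr0 -(mul0r (fR i phi p)) -fR_lin.
by apply: fR_ext => t _ _; rewrite mul0r addr0.
Qed.

Definition commEF p : C := (wts p - (wts p)^-1) / brace 1.

Lemma fF_wts psi t : fF (fun u => wts u * psi u) t = q ^+ 2 * wts t * fF psi t.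
Proof.
rewrite -fF_scale; apply: fF_ext => u su eu; congr (_ * _).
rewrite !wtsE su -eu mulnS exprD invfM; field.
by rewrite expf_neq0.
Qed.

(** The cross terms cancel: [F] on the tail picks up [q^2] when passing [wts], and so does
    [(wt k)^-1] when [k] is raised by one. *)
Lemma fE_fF phi p : fE (fF phi) p = fF (fE phi) p + commEF p * phi p.
Proof.
elim: p phi => [|k t IH] phi /=.
  by rewrite /commEF /wts big_nil invr1 subrr !mul0r addr0.
rewrite fE_lin IH -[fF (fun u => fE phi (k :: u)) t]/(fF (fun u => _ + _) t) fF_add.
have -> : fF (fun u => phi (k.+1 :: u) * wts u) t
    = q ^+ 2 * wts t * fF (fun u => phi (k.+1 :: u)) t.
  by rewrite -fF_wts; apply: fF_ext => u _ _; rewrite mulrC.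
have -> : bint k ^+ 2 * (phi (k.-1.+1 :: t) * wts t + fE (fun u => phi (k.-1 :: u)) t)
   = bint k ^+ 2 * phi (k :: t) * wts t + bint k ^+ 2 * fE (fun u => phi (k.-1 :: u)) t.
  by case: (k) => [|k'] /=; [rewrite bint0 expr0n !mul0r addr0 | ring].
have -> : bint k.+1 ^+ 2 = bint k ^+ 2 + (wt k - (wt k)^-1) / brace 1.
  by rewrite -bint_sqS mulrC mulKf ?brace1_neq0 //; ring.
rewrite wtS /commEF wts_cons; field.
by rewrite brace1_neq0 wts_neq0 wt_neq0 q_neq0.
Qed.

Lemma fR_commEF i phi p : fR i (fun u => commEF u * phi u) p = commEF p * fR i phi p.
Proof.
rewrite -fR_scale; apply: fR_ext => u su eu.
by rewrite /commEF !wtsE su eu.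
Qed.

Lemma fR_wts i phi p : fR i (fun u => phi u * wts u) p = fR i phi p * wts p.
Proof.
rewrite mulrC -fR_scale; apply: fR_ext => u su eu.
by rewrite mulrC !wtsE su eu.
Qed.

Lemma fR0_head0 phi b c t : in_range phi -> head0 phi ->
  fR0 phi [:: b, c & t] = if c == 0%N then s ^- b * phi [:: 0%N, b & t] else 0.
Proof.
move=> rp hp /=; case: ltnP => br; last first.
  by case: ifP => // _; rewrite rp ?mulr0 //= (ltnNge b) br andbF.
rewrite big_nat_recl // rcoef0 // mul1r addn0 subn0 big1 ?addr0; last first.
  by move=> a _; rewrite hp ?mulr0 // addnS.
case: c => [|c]; last by rewrite hp // mulr0.
by rewrite /rdiag addn0 muln0 mul0n expr0 mulr1.
Qed.

Lemma fR_fE i phi : in_range phi -> fR i (fE phi) = fE (fR i phi).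
Proof.
move=> rp; elim: i phi rp => [|i IH] phi rp; last first.
  apply/funext => -[|k t] //=; have := IH _ (in_range_cons k rp).
  move=> /(congr1 (@^~ t)) /= <-; rewrite -[RHS]/(_ + _) -fR_wts.
  by rewrite -[LHS]/(fR i (fun u => _ + _) t) fR_add.

apply: (in_range_ind (P := fun phi => fR 0 (fE phi) = fE (fR 0 phi))) rp.
- by move=> {}phi psi e1 e2; rewrite fE_add !fR_add fE_add e1 e2.
(* [E F] and [F E] differ by [commEF], which depends only on length and weight and so commutes with
   [R]. *)
- move=> {}phi _ e; rewrite fR_fF.
  have EF psi : fE (fF psi) = fun p => fF (fE psi) p + commEF p * psi p.
    by apply/funext => p; apply: fE_fF.
  rewrite !EF fR_add fR_fF e; apply/funext => p.
  by rewrite fR_commEF.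
move=> {}phi rp hp; apply/funext => -[|b [|c t]] //.
  by rewrite /= mul0r addr0.
have hE : head0 (fE phi).
  move=> k u k0; rewrite /= hp // mul0r add0r -[RHS](fE0 u).
  by apply: fE_ext => v _ _; apply: hp.
rewrite [LHS]fR0_head0 //; last exact: in_range_fE.
rewrite -[RHS]/(fR0 phi [:: b.+1, c & t] * wts (c :: t) +
  (fR0 phi [:: b, c.+1 & t] * wts t + fE (fun u => fR0 phi [:: b, c & u]) t)).
rewrite !fR0_head0 // mul0r add0r.
have -> : fE (fun u => fR0 phi [:: b, c & u]) t =
    if c == 0%N then s ^- b * fE (fun u => phi [:: 0%N, b & u]) t else 0.
  case: c => [|c] /=; last first.
    rewrite -[RHS](fE0 t); apply: fE_ext => u _ _.
    by rewrite -/(fR0 phi [:: b, c.+1 & u]) fR0_head0.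
  rewrite -fE_scale; apply: fE_ext => u _ _.
  by rewrite -/(fR0 phi [:: b, 0%N & u]) fR0_head0.
case: c => [|c] /=; last by rewrite mul0r addr0.
rewrite hp // mul0r add0r wts_cons /wt muln0 expr0 invr1 mulr1 exprS.
by field; rewrite s_neq0 expf_neq0 ?s_neq0.
Qed.

Lemma fR_head0 i phi : head0 phi -> head0 (fR i.+1 phi).
Proof.
move=> hp k t k0 /=; transitivity (fR i (fun u => 0 * phi u) t).
  by apply: fR_ext => u _ _; rewrite hp // mul0r.
by rewrite fR_scale mul0r.
Qed.

(** * Braid relations and injectivity *)

Lemma fR_braid i phi : in_range phi ->
  fR i (fR i.+1 (fR i phi)) = fR i.+1 (fR i (fR i.+1 phi)).
Proof.
move=> rp; elim: i phi rp => [|i IH] phi rp; last first.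
  apply/funext => -[|k t] //=; have := IH _ (in_range_cons k rp).
  by move=> /(congr1 (@^~ t)).
apply: (in_range_ind (P := fun phi =>
  fR 0 (fR 1 (fR 0 phi)) = fR 1 (fR 0 (fR 1 phi)))) rp.
- by move=> {}phi psi e1 e2; rewrite !fR_add e1 e2.
- by move=> {}phi _ e; rewrite !fR_fF e.
move=> {}phi rp hp; apply/funext => -[|b [|c [|d t]]] //.
- rewrite [LHS]/=; case: ifP => // _; rewrite big1 ?mulr0 // => a _.
  by rewrite mulr0.
have rR : in_range (fR 1 phi) by apply: in_range_fR.
rewrite -[RHS]/(fR0 (fun u => fR0 (fR 1 phi) (b :: u)) [:: c, d & t]).
rewrite -[LHS]/(fR0 (fR 1 (fR 0 phi)) [:: b, c, d & t]).
(* Both sides carry [u_0] to the third place and apply [R] to the other two factors, in opposite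
   orders. The scalar [s^-(b+c)] depends only on the weight of these two factors, which [R]
   preserves. *)
have -> : fR0 (fun u => fR0 (fR 1 phi) (b :: u)) [:: c, d & t]
    = if d == 0%N then s ^- (b + c) * fR0 (fun u => phi (0%N :: u)) [:: b, c & t] else 0.
  rewrite fR0_head0; first last.
  - by case=> // c' u c'0; rewrite fR0_head0 ?gtn_eqF //; apply: fR_head0.
  - by apply: in_range_cons; apply: (in_range_fR 0).
  case: eqP => // _; rewrite fR0_head0 //; last exact: fR_head0.
  by rewrite /= exprD invfM mulrA [s ^- c * _]mulrC.
have H x y : fR 1 (fR 0 phi) [:: x, y, d & t]
   = if d == 0%N then s ^- (x + y) * phi [:: 0%N, x, y & t] else 0.
  rewrite -[LHS]/(fR0 (fun u => fR0 phi (x :: u)) [:: y, d & t]).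
  rewrite fR0_head0; first last.
  - by case=> // c' u c'0; rewrite fR0_head0 ?gtn_eqF.
  - by apply: in_range_cons; apply: (in_range_fR 0).
  case: eqP => // _; rewrite fR0_head0 //=.
  by rewrite exprD invfM mulrA [s ^- y * _]mulrC.
rewrite /fR0; case: ifP => br; last by rewrite mulr0 if_same.
under eq_big_nat => a ab do rewrite H.
case: eqP => _; last by rewrite big1 ?mulr0 // => a _; rewrite mulr0.
rewrite [RHS]mulrCA; congr (_ * _); rewrite mulr_sumr; apply: eq_big_nat => a ab.
rewrite mulrCA (_ : c + a + (b - a) = b + c)%N //; lia.
Qed.

Lemma fR_far i j phi : (i.+1 < j)%N -> fR i (fR j phi) = fR j (fR i phi).
Proof.
elim: i j phi => [|i IH] [|j] phi // ij; last first.
  apply/funext => -[|k t] //=; have := IH j (fun u => phi (k :: u)) ij.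
  by move=> /(congr1 (@^~ t)).
case: j ij => // j _; apply/funext => -[|b [|c t]] //=.
case: ifP => br.
  rewrite (fR_scale j) -/(fR j) (lin_sum (fun x y phi psi => fR_lin j x y phi psi t)).
  by [].
rewrite -[LHS](mul0r (fR j (fun=> 0) t)) -fR_scale.
by apply: fR_ext => u _ _; rewrite mul0r.
Qed.

Lemma fR_inj i phi : in_range phi ->
  (forall p, (i.+1 < size p)%N -> fR i phi p = 0) ->
  forall p, (i.+1 < size p)%N -> phi p = 0.
Proof.
elim: i phi => [|i IH] phi rp z p sp; last first.
  case: p sp => // k t st; apply: (IH (fun u => phi (k :: u))) => //.
    exact: in_range_cons.
  by move=> u su; apply: (z (k :: u)).
case: p sp => [|x [|y t]] // _.
(* Triangularity: at the output [[:: y, x & t]] the term [a = 0] is the swapped value of [phi], and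
   the other terms have a second entry smaller than [y]. *)
elim/ltn_ind: y x => y IHy x.
have [yr|ry] := ltnP y r; last by rewrite rp //= (ltnNge y) ry andbF.
have := z [:: y, x & t] isT; rewrite /= yr big_nat_recl // rcoef0 // addn0 subn0.
rewrite mul1r big_nat big1 => [|a ay]; last by rewrite IHy ?mulr0 //; lia.
rewrite addr0 => /eqP; rewrite mulf_eq0 => /orP[|/eqP //].
by rewrite mulf_eq0 invr_eq0 !expf_eq0 (negbTE q_neq0) (negbTE s_neq0) !andbF.
Qed.

(** Downward induction on the first entry [k], started by the weight bound: once the slices above
    [k] vanish, the value of [F phi] at [k.+1 :: t] is [[k+1]^2 phi (k :: t)], and [k + 1 < r]. *)
Lemma fF_inj phi N : (N.+1 < r)%N -> (forall p, phi p != 0 -> (sumn p <= N)%N) ->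
  (forall p, fF phi p = 0) -> forall p, (0 < size p)%N -> phi p = 0.
Proof.
move=> Nr sp z [|k t] // _; have [d] := ubnP (r - k)%N.
elim: d k t => // d IH k t kd.
have [rk|kr] := leqP r.-1 k.
  by apply/eqP; apply: contraT => /sp /=; lia.
have := z (k.+1 :: t); rewrite /=.
have -> : fF (fun u => phi (k.+1 :: u)) t = 0.
  by rewrite -[RHS](fF0 t); apply: fF_ext => u _ _; apply: IH; lia.
rewrite mulr0 addr0 => /eqP; rewrite mulf_eq0 expf_eq0 /= => /orP[|/eqP //].
by rewrite (negbTE (bint_neq0 _)) //; lia.
Qed.

Definition fRw (w : seq nat) phi : fn := foldr fR phi w.

Lemma fRw_fE w phi : in_range phi -> fE (fRw w phi) = fRw w (fE phi).
Proof.
move=> rp; suff: in_range (fRw w phi) /\ fE (fRw w phi) = fRw w (fE phi) by case.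
elim: w => //= i w [rw <-]; split; first exact: in_range_fR.
by rewrite fR_fE.
Qed.

Lemma in_range_fRw w phi : in_range phi -> in_range (fRw w phi).
Proof. by move=> rp; elim: w => //= i w; apply: in_range_fR. Qed.

Lemma fRw0 w : fRw w (fun=> 0) = fun=> 0.
Proof.
elim: w => //= i w ->; apply/funext => p.
transitivity (fR i (fun=> 0 * 0) p); last by rewrite fR_scale mul0r.
by apply: fR_ext => t _ _; rewrite mul0r.
Qed.

Lemma fRw_shift w phi x p :
  fRw (map succn w) phi (x :: p) = fRw w (fun u => phi (x :: u)) p.
Proof.
suff E : (fun p => fRw (map succn w) phi (x :: p)) = fRw w (fun u => phi (x :: u)).
  by rewrite -E.
by elim: w => //= i w <-.
Qed.

Lemma fRw_iota_head0 m phi p : size p = m ->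
  fRw (iota 0 m) phi (0%N :: p) = s ^- (sumn p) * phi (rcons p 0%N).
Proof.
elim: m p phi => [|m IH] [|c t] phi //=; first by rewrite invr1 mul1r.
case=> st; rewrite -[LHS]/(fR0 (fRw (iota 1 m) phi) [:: 0%N, c & t]) /=.
rewrite r_gt0 big_nat1 rcoef0 // mul1r subn0 addn0 (iotaDl 1 0).
rewrite fRw_shift IH // /rdiag add0n !muln0 expr0 mulr1.
by rewrite mulrA exprD invfM.
Qed.

Lemma fE_rcons phi p k :
  fE phi (rcons p k) = fE (fun u => phi (rcons u k)) p * wt k + phi (rcons p k.+1).
Proof.
elim: p phi => [|x p IH] phi /=; first by rewrite mul0r add0r addr0 /wts big_nil mulr1.
by rewrite IH -cats1 wts_cat /wts big_seq1 cats1; ring.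
Qed.

(* [kap n l] is the eigenvalue of [K] in weight [l - 1], also when [l = 0]. *)
Definition kap n l : C := q ^+ 2 * (s ^+ n * q ^- (2 * l)).

Lemma kap_neq0 n l : kap n l != 0.
Proof. by rewrite !mulf_neq0 ?invr_eq0 ?expf_neq0 ?s_neq0. Qed.

Lemma kapS n l : kap n l = kap n l.+1 * q ^+ 2.
Proof.
rewrite /kap mulnS exprD; field.
by rewrite !expf_neq0.
Qed.

Lemma kap_wts j p : kap (size p).+1 (j.+1 + sumn p) = wts p * wt j.
Proof.
rewrite /kap wtsE /wt addSn mulnS mulnDr !exprD !exprS; field.
by rewrite !expf_neq0 q_neq0.
Qed.

Lemma bint_sqS_wt j :
  wt j * (wt j + brace 1 * bint j ^+ 2) - 1 = brace 1 * wt j * bint j.+1 ^+ 2.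
Proof.
have -> : brace 1 * wt j * bint j.+1 ^+ 2 =
    wt j * (brace 1 * (bint j.+1 ^+ 2 - bint j ^+ 2)) + brace 1 * wt j * bint j ^+ 2.
  by ring.
by rewrite bint_sqS; field; apply: wt_neq0.
Qed.

(** * Rotation of tensor factors and the full twist *)

Section Rotation.
Variable m : nat.
Local Notation delta := (fRw (iota 0 m)).

(** Bringing [u_0] to the front costs [s^-l]; each passage from slice [j] to [j + 1] costs one more
    inverse eigenvalue of [K]. *)
Definition gam l j : C := s ^- l * kap m.+1 l ^- j.

Lemma gamS l j : gam l j.+1 = gam l j * (kap m.+1 l)^-1.
Proof. by rewrite /gam exprS invfM; ring. Qed.

Lemma gam_pred l j : gam l j = gam l.+1 j * wt j.
Proof.
rewrite /gam kapS /wt exprMn -exprM !exprS; field.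
by rewrite !expf_neq0 ?kap_neq0 ?s_neq0.
Qed.

(** [E] determines the slices of [delta psi] recursively along the first factor and those of [psi]
    along the last. The two recursions differ by the factor [wts p * wt j], which is [kap]. *)
Lemma rotation_ker psi j p : in_range psi -> fE psi = (fun=> 0) -> size p = m ->
  delta psi (j :: p) = gam (j + sumn p) j * psi (rcons p j).
Proof.
move=> rp ep; elim: j p => [|j IH] p sp.
  by rewrite fRw_iota_head0 // /gam add0n expr0 invr1 mulr1.
have := congr1 (@^~ (j :: p)) (fRw_fE (iota 0 m) rp).
rewrite ep fRw0 /= => e0.
have e1 : fE (fun u => delta psi (j :: u)) p =
    gam (j.+1 + sumn p) j * fE (fun u => psi (rcons u j)) p.
  rewrite -fE_scale; apply: fE_ext => u su eu.
  by rewrite IH ?su // eu addnS.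
have := congr1 (@^~ (rcons p j)) ep; rewrite /= fE_rcons => e2.
move: e0; rewrite e1 => /eqP; rewrite addr_eq0 => /eqP e0.
apply: (mulIf (wts_neq0 p)); rewrite e0 gamS -sp kap_wts.
have /eqP := e2; rewrite addrC addr_eq0 => /eqP ->.
by field; rewrite wts_neq0 wt_neq0.
Qed.

(** The same recursion with source [E phi], which lies in the kernel of [E] and is rotated by
    [rotation_ker]. The coefficient of the correction is its solution with value [0] at [j = 0];
    [bint_sqS_wt] is the inductive step. *)
Lemma rotation_ker2 phi j p : in_range phi ->
  fE (fE phi) = (fun=> 0) -> size p = m ->
  delta phi (j :: p) = gam (j + sumn p) j *
    (phi (rcons p j) + brace 1 * wt j.-1 * bint j ^+ 2 * fE phi (rcons p j.-1)).
Proof.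
move=> rp; have := in_range_fE rp; set psi := fE phi => rpsi ep.
elim: j p => [|j IH] p sp.
  rewrite fRw_iota_head0 // /gam add0n expr0 invr1 mulr1.
  by rewrite bint0 expr0n mulr0 mul0r addr0.
have := congr1 (@^~ (j :: p)) (fRw_fE (iota 0 m) rp).
rewrite /= -/psi (rotation_ker j rpsi ep sp) => e0.
have e1 : fE (fun u => delta phi (j :: u)) p =
    gam (j.+1 + sumn p) j * (fE (fun u => phi (rcons u j)) p +
     brace 1 * wt j.-1 * bint j ^+ 2 * fE (fun u => psi (rcons u j.-1)) p).
  rewrite -[X in _ = _ * (X + _)]mul1r -fE_lin -fE_scale; apply: fE_ext => u su eu.
  by rewrite IH ?su // eu addnS mul1r.
have e2 : brace 1 * wt j.-1 * bint j ^+ 2 * fE (fun u => psi (rcons u j.-1)) p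
    = - (brace 1 * bint j ^+ 2 * psi (rcons p j)).
  case: (j) => [|i]; first by rewrite bint0 expr0n !(mulr0, mul0r) oppr0.
  have := congr1 (@^~ (rcons p i)) ep; rewrite /= fE_rcons => /eqP.
  rewrite addrC addr_eq0 => /eqP ->; ring.
have e3 := fE_rcons phi p j; rewrite -/psi in e3.
rewrite e2 in e1; rewrite e1 in e0.
apply: (mulIf (wts_neq0 p)).
move/esym/eqP: e0; rewrite -subr_eq => /eqP <-.
move/eqP: e3; rewrite -subr_eq => /eqP/esym/(canRL (mulfK (wt_neq0 j))) ->.
rewrite addSn [gam (j + _) j]gam_pred gamS -sp -addSn kap_wts.
rewrite -(bint_sqS_wt j) /=.
by field; rewrite wts_neq0 wt_neq0.
Qed.

Definition gams l a : C := s ^- (l * size a) * kap m.+1 l ^- sumn a.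

Lemma gams_cons l j a : gams l (j :: a) = gam l j * gams l a.
Proof. by rewrite /gams /gam /= mulnS !exprD !invfM; ring. Qed.

Lemma gams_pred l a : gams l a = gams l.+1 a * wts a.
Proof.
elim: a => [|j a IH]; first by rewrite /gams /wts big_nil /= !muln0 mulr1.
by rewrite !gams_cons IH gam_pred wts_cons; ring.
Qed.

Lemma iter_fRw_in_range k phi : in_range phi -> in_range (iter k delta phi).
Proof. by move=> rp; elim: k => //= k; apply: in_range_fRw. Qed.

Lemma iter_fRw_fE k phi : in_range phi ->
  fE (iter k delta phi) = iter k delta (fE phi).
Proof.
move=> rp; elim: k => //= k IH; rewrite fRw_fE ?IH //.
exact: iter_fRw_in_range.
Qed.

Lemma iter_fRw0 k : iter k delta (fun=> 0) = fun=> 0.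
Proof. by elim: k => //= k ->; apply: fRw0. Qed.

Lemma iter_rotation_ker psi a b : in_range psi -> fE psi = (fun=> 0) ->
  (size a + size b)%N = m.+1 ->
  iter (size a) delta psi (a ++ b) = gams (sumn a + sumn b) a * psi (b ++ a).
Proof.
move=> rp ep; elim: a b => [|j a IH] b sab.
  by rewrite /gams muln0 !expr0 invr1 !mul1r cats0.
rewrite [LHS]/= rotation_ker; first last.
- by move: sab; rewrite /= size_cat => -[].
- by rewrite iter_fRw_fE // ep iter_fRw0.
- exact: iter_fRw_in_range.
rewrite rcons_cat IH; last by rewrite size_rcons; move: sab => /=; lia.
rewrite cat_rcons sumn_rcons sumn_cat gams_cons mulrA /=.
by congr (gam _ _ * gams _ _ * _); lia.
Qed.

(** Each rotated letter [j] contributes a term with coefficient [[j]^2], that is, one summand of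
    [F]; over the block [a] the corrections add up to [F] on that block applied to [E phi]. *)
Lemma iter_rotation_ker2 phi a b : in_range phi ->
  fE (fE phi) = (fun=> 0) -> (size a + size b)%N = m.+1 ->
  iter (size a) delta phi (a ++ b) = gams (sumn a + sumn b) a *
   (phi (b ++ a) + brace 1 * q ^+ 2 * wts a * fF (fun u => fE phi (b ++ u)) a).
Proof.
move=> rp ep; elim: a b => [|j a IH] b sab.
  by rewrite /gams muln0 !expr0 invr1 !mul1r cats0 /= mulr0 addr0.
have sab' : (size a + size (rcons b j))%N = m.+1.
  by rewrite size_rcons; move: sab => /=; lia.
rewrite [LHS]/= rotation_ker2; first last.
- by move: sab; rewrite /= size_cat => -[].
- by rewrite !iter_fRw_fE ?ep ?iter_fRw0 //; apply: in_range_fE.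
- exact: iter_fRw_in_range.
rewrite !rcons_cat IH // iter_fRw_fE // cat_rcons.
have -> : brace 1 * wt j.-1 * bint j ^+ 2 *
      iter (size a) delta (fE phi) (a ++ rcons b j.-1) =
    gams (sumn (j :: a) + sumn b) a * (brace 1 * q ^+ 2 * wt j * wts a) *
      (bint j ^+ 2 * fE phi (b ++ j.-1 :: a)).
  case: j {sab IH} sab' => [|j] sab; first by rewrite bint0 expr0n !(mulr0, mul0r).
  rewrite iter_rotation_ker //; first last.
  - by move: sab; rewrite !size_rcons.
  - exact: in_range_fE.
  rewrite cat_rcons sumn_rcons /= wtS (_ : _ + _ = sumn a + sumn b + j)%N; last by lia.
  rewrite gams_pred.
  rewrite (_ : (sumn a + sumn b + j).+1 = j.+1 + sumn a + sumn b)%N; last by lia.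
  by field; rewrite q_neq0.
rewrite sumn_rcons sumn_cat gams_cons wts_cons /=.
rewrite (_ : sumn a + (sumn b + j) = j + sumn a + sumn b)%N; last by lia.
rewrite (_ : j + (sumn a + sumn b) = j + sumn a + sumn b)%N; last by lia.
have -> : fF (fun u => fE phi (rcons b j ++ u)) a = fF (fun u => fE phi (b ++ j :: u)) a.
  by apply: fF_ext => u _ _; rewrite cat_rcons.
by field; apply: wt_neq0.
Qed.

Lemma full_twist_ker2 phi p : in_range phi -> fE (fE phi) = (fun=> 0) ->
  size p = m.+1 ->
  iter m.+1 delta phi p = gams (sumn p) p *
    (phi p + brace 1 * q ^+ 2 * wts p * fF (fE phi) p).
Proof.
move=> rp ep sp.
have := @iter_rotation_ker2 phi p [::] rp ep (etrans (addn0 _) sp).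
by rewrite (addn0 (sumn p)) cats0 sp.
Qed.
End Rotation.

(** * Weight supports and the equation [E phi = psi] *)

Definition supp n l phi := forall p, phi p != 0 -> size p = n /\ sumn p = l.

Lemma suppP n l phi :
  supp n l phi <-> forall p, ~~ ((size p == n) && (sumn p == l)) -> phi p = 0.
Proof.
split=> [sp p|z p]; first by apply: contraNeq => /sp[-> ->]; rewrite !eqxx.
have [/andP[/eqP -> /eqP ->] //|/z ->] := boolP ((size p == n) && (sumn p == l)).
by rewrite eqxx.
Qed.

Lemma supp_in_range n l phi : (l < r)%N -> supp n l phi -> in_range phi.
Proof.
move=> lr sp p np; apply/eqP; apply: contraNT np => /sp[_ lp].
apply/allP => k kp /=; apply: leq_ltn_trans lr; rewrite -lp.
by elim: p kp {lp} => //= x p IH; rewrite inE => /orP[/eqP ->|/IH]; lia.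
Qed.

Fixpoint solve_slices phi0 psi k : fn :=
  if k is j.+1 then
    fun p => (wts p)^-1 * (psi (j :: p) - fE (solve_slices phi0 psi j) p)
  else phi0.

(* [E phi = psi] is solved recursively for the slices [phi (k :: _)], starting
   from an arbitrary slice [k = 0]. *)
Lemma fE_solve m l phi0 psi : supp m l phi0 ->
  (forall p, psi p != 0 -> size p = m.+1 /\ (sumn p).+1 = l) ->
  exists phi, [/\ supp m.+1 l phi, fE phi = psi & forall p, phi (0%N :: p) = phi0 p].
Proof.
move=> s0 s1; exists (fun p => if p is k :: t then solve_slices phi0 psi k t else 0).
have sl k p : ~~ ((size p == m) && (k + sumn p == l)%N) ->
    solve_slices phi0 psi k p = 0.
  elim: k p => [|k IH] p np /=; first exact: (suppP _ _ _).1 s0 _ np.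
  have -> : psi (k :: p) = 0.
    by apply: contraNeq np => /s1[/= [->] <-]; rewrite !eqxx.
  rewrite sub0r [fE _ p](_ : _ = 0) ?oppr0 ?mulr0 // -[RHS](fE0 p).
  by apply: fE_ext => t st et; apply: IH; rewrite st et addnS.
split=> //.
- by apply/suppP => -[|k t] //=; rewrite eqSS; apply: sl.
- apply/funext => -[|k t] /=.
    by apply/esym/eqP; apply: contraT => /s1[].
  by rewrite mulrAC mulVf ?wts_neq0 // mul1r subrK.
Qed.

Lemma fE_supp n l phi : supp n l.+1 phi -> supp n l (fE phi).
Proof.
move=> /suppP sp; apply/suppP => p np; rewrite -(fE0 p).
by apply: fE_ext => t st et; apply: sp; rewrite st et eqSS.
Qed.

Lemma fF_supp n l phi : supp n l phi -> supp n l.+1 (fF phi).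
Proof.
move=> /suppP sp; apply/suppP => p np; rewrite -(fF0 p).
by apply: fF_ext => t st et; apply: sp; rewrite st -(eqSS (sumn t)) et.
Qed.

Lemma fR_supp i n l phi : supp n l phi -> supp n l (fR i phi).
Proof.
move=> /suppP sp; apply/suppP => p np; rewrite -(mul0r (fR i phi p)) -fR_scale.
by apply: fR_ext => t st et; rewrite mul0r sp // st et.
Qed.
End QuantumModel.

(** * The Steinberg module in coordinates *)

Section RootOfUnity.
Variables (R : realType) (r : nat).
Hypothesis r_gt1 : (1 < r)%N.
Local Notation C := (R[i]).
Local Notation q := (q R r).
Local Notation s := (s R r).

Let ang (k : nat) : R := k%:R * (pi / r%:R).

Lemma q_expE k : q ^+ k = (cos (ang k) +i* sin (ang k))%C.
Proof.
elim: k => [|k IH]; first by rewrite expr0 /ang mul0r cos0 sin0.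
have -> : ang k.+1 = ang k + pi / r%:R by rewrite /ang -natr1 mulrDl mul1r.
rewrite exprSr IH cosD sinD /q.
by apply/eqP; rewrite eq_complex /= eqxx /= addrC.
Qed.

Lemma q_expVE k : q ^- k = (cos (ang k) -i* sin (ang k))%C.
Proof.
have H : q ^+ k * (cos (ang k) -i* sin (ang k))%C = 1.
  rewrite q_expE; apply/eqP; rewrite eq_complex /=.
  by rewrite mulrN opprK -!expr2 cos2Dsin2 eqxx /= mulrN mulrC addNr.
have q0 : q ^+ k != 0.
  by apply/eqP => e; move/eqP: H; rewrite e mul0r eq_sym oner_eq0.
by apply: (mulfI q0); rewrite H divff.
Qed.

Lemma q_neq0 : q != 0.
Proof.
apply/negP => /eqP e; have := q_expVE 1; have := q_expE 1; rewrite expr1 e invr0.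
move=> /eqP; rewrite eq_complex /= => /andP[/eqP h1 /eqP h2].
have := cos2Dsin2 (ang 1); rewrite -h1 -h2 !expr0n /= addr0 => /esym/eqP.
by rewrite oner_eq0.
Qed.

Lemma q_expr : q ^+ r = -1.
Proof.
rewrite q_expE /ang mulrCA mulfV ?mulr1; last by rewrite pnatr_eq0; lia.
by rewrite cospi sinpi; apply/eqP; rewrite eq_complex /= oppr0 !eqxx.
Qed.

Lemma s_qV : s = - q^-1.
Proof.
apply: (mulfI q_neq0); rewrite /s -exprS prednK; last by lia.
by rewrite q_expr mulrN divff ?q_neq0.
Qed.

Lemma qbrace_neq0 k : (0 < k < r)%N -> qbrace R r k != 0.
Proof.
case/andP=> k0 kr; rewrite /qbrace q_expVE q_expE eq_complex /= negb_and opprK.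
(* The imaginary part is [2 sin (k pi / r)], with an angle strictly between [0] and [pi]. *)
apply/orP; right; rewrite -mulr2n mulrn_eq0 /=.
apply: lt0r_neq0; apply: sin_gt0_pi; rewrite /ang.
have r0 : (0 : R) < r%:R by rewrite ltr0n; lia.
rewrite mulr_gt0 ?divr_gt0 ?pi_gt0 ?r0 ?ltr0n //=.
by rewrite mulrCA gtr_pMr ?pi_gt0 // ltr_pdivrMr // mul1r ltr_nat.
Qed.

Lemma qint_r : qint R r r = 0.
Proof. by rewrite /qint /qbrace q_expr invrN invr1 subrr mul0r. Qed.

Lemma qint_neq0 k : (0 < k < r)%N -> qint R r k != 0.
Proof. by move=> kr; rewrite mulf_neq0 ?invr_eq0 ?qbrace_neq0. Qed.

Lemma qint_sub m : (m <= r)%N -> qint R r (r - m) = qint R r m.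
Proof.
move=> mr; rewrite /qint /qbrace; congr (_ / _).
have q0 : q ^+ m != 0 by rewrite expf_neq0 ?q_neq0.
have -> : q ^+ (r - m) = - q ^- m.
  by apply: (mulfI q0); rewrite -exprD subnKC // q_expr mulrN divff.
by rewrite invrN invrK opprK addrC.
Qed.

End RootOfUnity.

(** * Vectors as coefficient functions on words *)

Section Coordinates.
Variables (C : fieldType) (r n : nat).
Local Notation vect := {ffun {ffun 'I_n -> 'I_r} -> C^o}.
Implicit Types (e : {ffun 'I_n -> 'I_r}) (v : vect) (p : seq nat).

Definition cl e : seq nat := [seq nat_of_ord (e i) | i <- enum 'I_n].

Lemma size_cl e : size (cl e) = n.
Proof. by rewrite size_map size_enum_ord. Qed.

Lemma nth_cl e (i : 'I_n) : nth 0%N (cl e) i = e i.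
Proof. by rewrite (nth_map i) ?size_enum_ord // nth_ord_enum. Qed.

Lemma cl_eqP e p : size p = n ->
  reflect (forall i : 'I_n, e i = nth 0%N p i :> nat) (cl e == p).
Proof.
move=> sp; apply: (iffP eqP) => [<- i|H]; first by rewrite nth_cl.
apply: (@eq_from_nth _ 0%N); first by rewrite size_cl sp.
by move=> i; rewrite size_cl => ni; rewrite (nth_cl e (Ordinal ni)) H.
Qed.

Lemma cl_inj : injective cl.
Proof.
move=> e e' /eqP/(cl_eqP _ (size_cl _)) H; apply/ffunP => i; apply/val_inj.
by rewrite /= H nth_cl.
Qed.

Lemma cl_range e : all (gtn r) (cl e).
Proof. by apply/allP => _ /mapP[i _ ->] /=; apply: ltn_ord. Qed.

Lemma cl_surj p : size p = n -> all (gtn r) p -> exists e, cl e = p.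
Proof.
move=> sp /all_nthP rp.
have H (i : 'I_n) : (nth 0%N p i < r)%N by apply: rp; rewrite sp.
exists [ffun i => Ordinal (H i)]; apply/eqP/cl_eqP => // i.
by rewrite ffunE.
Qed.

(** A sum with at most one term: a word of the wrong length or with a letter [>= r] automatically
    gets the coefficient [0]. *)
Definition cf v p : C := \sum_(e | cl e == p) (v e : C).

Lemma cf_cl v e : cf v (cl e) = v e.
Proof.
rewrite /cf (eq_bigl (pred1 e)); first by rewrite big_pred1_eq.
by move=> e'; rewrite (inj_eq cl_inj).
Qed.

Lemma cf_size v p : size p != n -> cf v p = 0.
Proof. by move=> sp; rewrite /cf big1 // => e /eqP E; rewrite -E size_cl eqxx in sp. Qed.

Lemma cf_in_range v : in_range r (cf v).
Proof.
by move=> p np; rewrite /cf big1 // => e /eqP E; rewrite -E cl_range in np.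
Qed.

Lemma cf_eq v phi : in_range r phi -> (forall p, size p != n -> phi p = 0) ->
  (forall e, v e = phi (cl e)) -> cf v = phi.
Proof.
move=> rp sp H; apply/funext => p.
have [pn|pn] := eqVneq (size p) n; last by rewrite cf_size // sp.
have [rgp|rgp] := boolP (all (gtn r) p); last by rewrite cf_in_range // rp.
by have [e <-] := cl_surj pn rgp; rewrite cf_cl H.
Qed.

Lemma cf_inj v w : cf v = cf w -> v = w.
Proof. by move=> H; apply/ffunP => e; rewrite -!cf_cl H. Qed.

Lemma cf_lin a b v w : cf (a *: v + b *: w) = fun p => a * cf v p + b * cf w p.
Proof.
apply/funext => p; rewrite /cf !mulr_sumr -big_split; apply: eq_bigr => e _.
by rewrite !ffunE.
Qed.

Lemma linext_ffun (I J : finType) (f : I -> {ffun J -> C^o}) (x : {ffun I -> C^o}) y :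
  linext f x y = \sum_i x i * f i y.
Proof.
by rewrite lfunE /= /linext_fun sum_ffunE; apply: eq_bigr => i _; rewrite !ffunE.
Qed.

(** An entry of a tensor product of operators is a product of scalars times Kronecker deltas; this
    merges the deltas into one condition on words. *)
Lemma prod_if (I : finType) (c : pred I) (g : I -> C) :
  \prod_i (if c i then g i else 0) = if [forall i, c i] then \prod_i g i else 0.
Proof.
case: ifP => [/forallP H|/negbT/forallPn[i /negbTE H]].
  by apply: eq_bigr => i _; rewrite H.
by rewrite (bigD1 i) //= H mul0r.
Qed.

End Coordinates.

Section ClosedForms.
Variables (C : fieldType) (q s : C).

Lemma fE_nth phi p : fE q s phi p = \sum_(0 <= i < size p)
  (\prod_(0 <= k < size p) (if (i < k)%N then wt q s (nth 0%N p k) else 1))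
  * phi (set_nth 0%N p i (nth 0%N p i).+1).
Proof.
elim: p phi => [|x p IH] phi /=; first by rewrite big_nil.
rewrite big_nat_recl //= mulrC; congr (_ * _ + _).
  rewrite big_nat_recl //= mul1r /wts.
  by rewrite (big_nth 0%N).
by rewrite IH; apply: eq_bigr => i _; rewrite [in RHS]big_nat_recl //= mul1r.
Qed.

Lemma fF_nth phi p : fF q s phi p = \sum_(0 <= i < size p)
  (\prod_(0 <= k < size p) (if (k < i)%N then (wt q s (nth 0%N p k))^-1 else 1))
  * (bint q (nth 0%N p i) ^+ 2 * phi (set_nth 0%N p i (nth 0%N p i).-1)).
Proof.
elim: p phi => [|x p IH] phi /=; first by rewrite big_nil.
rewrite big_nat_recl //=; congr (_ + _).
  by rewrite big1 ?mul1r.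
rewrite IH mulr_sumr; apply: eq_bigr => i _.
by rewrite [in RHS]big_nat_recl //= mulrA.
Qed.

Lemma fR_nth r i phi p : (i.+1 < size p)%N ->
  let b := nth 0%N p i in let c := nth 0%N p i.+1 in
  fR q s r i phi p = if (b < r)%N then rdiag q s b c *
    \sum_(0 <= a < b.+1) rcoef q b a *
      phi (set_nth 0%N (set_nth 0%N p i (c + a)) i.+1 (b - a))%N else 0.
Proof.
elim: i phi p => [|i IH] phi [|x p] //=; first by case: p.
by move=> ip; rewrite IH.
Qed.

End ClosedForms.

Section SteinbergCoordinates.
Variables (R : realType) (r n : nat).
Hypothesis r_gt1 : (1 < r)%N.
Local Notation C := (R[i]).
Local Notation q := (q R r).
Local Notation s := (s R r).
Local Notation wt := (wt q s).
Local Notation bint := (bint q).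
Implicit Types (e : {ffun 'I_n -> 'I_r}) (v : Vn R r n).

Lemma steinberg_paramP : steinberg_param q s r.
Proof.
split.
- exact: q_neq0.
- exact: s_qV.
- exact: (@qbrace_neq0 R r r_gt1 1 r_gt1).
- exact: ltnW.
- exact: qint_r.
- by move=> m; apply: (qint_neq0 R r_gt1).
Qed.
Let par := steinberg_paramP.

Lemma opE_bvec (j k : 'I_r) : opE R r (bvec C j) k = (j == k.+1 :> nat)%:R.
Proof.
rewrite /opE linextE; case: eqP => [->|/eqP j0]; first by rewrite ffunE.
by rewrite ffunE; congr (_%:R); lia.
Qed.

Lemma opK_coord (x : V R r) k : opK R r x k = wt k * x k.
Proof.
rewrite linext_ffun (bigD1 k) //= !ffunE eqxx [_ *: _]mulr1 big1 ?addr0 => [|j jk].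
  by rewrite mulrC.
have /negbTE jk' : (j != k :> nat) := jk.
by rewrite !ffunE eq_sym jk' [_ *: _]mulr0 mulr0.
Qed.

Lemma opK_bvec (j k : 'I_r) : opK R r (bvec C j) k = if j == k then wt k else 0.
Proof. by rewrite opK_coord ffunE eq_sym; case: eqP => _; rewrite ?mulr1 ?mulr0. Qed.

Lemma opKV_bvec (j k : 'I_r) :
  (opK R r)^-1%VF (bvec C j) k = if j == k then (wt k)^-1 else 0.
Proof.
have K0 : lker (opK R r) == 0%VS.
  apply/lker0P => x y /ffunP H; apply/ffunP => i; have := H i.
  by rewrite !opK_coord => /(mulfI (wt_neq0 par _)).
have := congr1 (fun x : V R r => x k) (lker0_lfunVK K0 (bvec C j)).
rewrite /= opK_coord ffunE [k == j]eq_sym => /(canRL (mulKf (wt_neq0 par _))) ->.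
by case: eqP => _; rewrite ?mulr1 ?mulr0.
Qed.

Lemma opF_bvec (j k : 'I_r) :
  opF R r (bvec C j) k = if j.+1 == k :> nat then bint k ^+ 2 else 0.
Proof.
rewrite /opF linextE !ffunE eq_sym; case: eqP => [jk|]; last by rewrite [_ *: _]mulr0.
rewrite jk (_ : r.-1 - j = r - k)%N; last by lia.
by rewrite [_ *: _]mulr1 qint_sub // ltnW.
Qed.

Lemma nE_coord v e : nE R r n v e = fE q s (cf v) (cl e).
Proof.
rewrite sum_lfunE sum_ffunE fE_nth size_cl big_mkord; apply: eq_bigr => i _.
rewrite linext_ffun /cf mulr_sumr [RHS]big_mkcond /=; apply: eq_bigr => e' _.
rewrite !ffunE big_mkord.
pose c (k : 'I_n) :=
    e' k == nth 0%N (set_nth 0%N (cl e) i (nth 0%N (cl e) i).+1) k :> nat.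
pose g (k : 'I_n) := if (i < k)%N then wt (nth 0%N (cl e) k) else 1.
rewrite (eq_bigr (fun k => if c k then g k else 0)) => [|k _]; last first.
  rewrite /c /g nth_set_nth /= !nth_cl -val_eqE /=.
  case: ltngtP => ki.
  - by rewrite id_lfunE ffunE -val_eqE /= eq_sym; case: eqP.
  - by rewrite opK_bvec -val_eqE.
  - have -> : k = i by apply: val_inj.
    by rewrite opE_bvec; case: eqP.
rewrite prod_if; have -> : [forall k, c k] =
    (cl e' == set_nth 0%N (cl e) i (nth 0%N (cl e) i).+1).
  apply/forallP/cl_eqP => [|H k|H k]; last by rewrite /c H.
    by rewrite size_set_nth size_cl; apply/maxn_idPr.
  exact/eqP/H.
by case: ifP => _; rewrite ?mulr0 // mulrC.
Qed.

Lemma nF_coord v e : nF R r n v e = fF q s (cf v) (cl e).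
Proof.
rewrite sum_lfunE sum_ffunE fF_nth size_cl big_mkord; apply: eq_bigr => i _.
rewrite linext_ffun /cf !mulr_sumr [RHS]big_mkcond /=; apply: eq_bigr => e' _.
rewrite !ffunE big_mkord.
pose c (k : 'I_n) := (if k == i then (e' k).+1 == e k :> nat else e' k == e k).
pose g (k : 'I_n) := (if (k < i)%N then (wt (nth 0%N (cl e) k))^-1 else 1)
   * (if k == i then bint (e k) ^+ 2 else 1).
rewrite (eq_bigr (fun k => if c k then g k else 0)) => [|k _]; last first.
  rewrite /c /g !nth_cl -val_eqE /=.
  case: ltngtP => ki.
  - by rewrite opKV_bvec mulr1.
  - by rewrite mulr1 id_lfunE ffunE eq_sym; case: eqP.
  - have -> : k = i by apply: val_inj.
    by rewrite opF_bvec mul1r.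
have Hi : \prod_(k < n) (if k == i then bint (e k) ^+ 2 else 1) = bint (e i) ^+ 2.
  rewrite (bigD1 i) //= eqxx big1 ?mulr1 // => k /negbTE -> //.
rewrite prod_if big_split /= Hi {Hi}.
(* For [e i = 0] no input index has successor [e i], while the predecessor truncates to [0]; the
   coefficient [[0]^2] reconciles the two sides. *)
rewrite nth_cl; case: (posnP (e i)) => ei0.
  rewrite ei0 bint0 expr0n mul0r !mulr0 !if_same.
  exact: mulr0.
have -> : [forall k, c k] = (cl e' == set_nth 0%N (cl e) i (e i).-1).
  apply/forallP/cl_eqP => [|H k|H k].
  - by rewrite size_set_nth size_cl; apply/maxn_idPr.
  - have := H k; rewrite /c nth_set_nth /= nth_cl -(inj_eq val_inj) /=.
    case: (nat_of_ord k =P i) => [/val_inj ->|_ /eqP -> //].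
    by move/eqP => <-.
  - have := H k; rewrite /c nth_set_nth /= nth_cl -(inj_eq val_inj) /=.
    case: (nat_of_ord k =P i) => [/val_inj -> ->|_ E]; last by apply/eqP/val_inj.
    by rewrite prednK.
by case: ifP => _; rewrite ?mulr0 // mulrC -mulrA.
Qed.

Lemma sum_nat_delta (F : nat -> C) N k : 
  (forall a, (a < N)%N -> a != k -> F a = 0) ->
  \sum_(0 <= a < N) F a = if (k < N)%N then F k else 0.
Proof.
move=> H; case: ifP => kN.
  rewrite big_mkord (bigD1 (Ordinal kN)) //= big1 ?addr0 // => a ak.
  exact: H (ltn_ord a) ak.
rewrite big_mkord big1 // => a _; apply: H => //.
by apply/eqP => E; move: (ltn_ord a); rewrite E kN.
Qed.

Lemma rcoefE (b a : nat) : (a <= b)%N -> (b < r)%N ->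
  rcoef q b a = q ^+ ((a * a.-1) %/ 2) * qbinom R r b (b - a)
    * \prod_(0 <= m < a) qbrace R r (m + (b - a) + 1).
Proof.
move=> ab br.
have fact0 m : (m < r)%N -> qfact R r m != 0.
  exact: (bfact_neq0 par).
have b1 : qbrace R r 1 != 0 := param_brace1_neq0 par.
have -> : \prod_(0 <= m < a) qbrace R r (m + (b - a) + 1) =
    qbrace R r 1 ^+ a * (qfact R r b / qfact R r (b - a)).
  have [d db] : exists d, b = (d + a)%N by exists (b - a)%N; rewrite subnK.
  rewrite db addnK; have : (d + a < r)%N by rewrite -db.
  elim: (a) => [|k IH] dr; first by rewrite big_nil addn0 divff ?mulr1 ?fact0 //; lia.
  rewrite big_nat_recr //= IH; last by lia.
  rewrite (addnS d k) /qfact [X in _ = _ * (X / _)]big_nat_recr //= -/(qfact R r _).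
  rewrite /qint exprSr (_ : k + d + 1 = (d + k).+1)%N; last by lia.
  field; rewrite b1 fact0 //; lia.
rewrite /rcoef /qbinom subKn // expr2.
rewrite -[bfact q a]/(qfact R r a) -[bfact q b]/(qfact R r b).
rewrite -[bfact q (b - a)]/(qfact R r (b - a)) -[brace q 1]/(qbrace R r 1).
by field; rewrite !fact0 //; lia.
Qed.

Lemma Rmat_coord (x y b c : 'I_r) : Rmat R r (bvec C (x, y)) (b, c) =
  rdiag q s b c * \sum_(0 <= a < b.+1) rcoef q b a *
    ((x == (c + a)%N :> nat) && (y == (b - a)%N :> nat))%:R.
Proof.
rewrite /Rmat linextE ffunE sum_ffunE /=.
under eq_bigr do rewrite ffunE ffunE /= ffunE ffunE.
(* The output index [b = y + a] leaves only [a = b - y] on either side; when [b < y] the difference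
   is truncated and both sides vanish. *)
rewrite (sum_nat_delta (k := (b - y)%N)) => [|a aN ne]; last first.
  by rewrite (_ : (b == (y + a)%N :> nat) = false) ?mul0r ?scaler0 //; lia.
rewrite (sum_nat_delta (k := (b - y)%N)) => [|a aN ne]; last first.
  by rewrite (_ : (y == (b - a)%N :> nat) = false) ?andbF ?mulr0 //; lia.
have br := ltn_ord b; have yr := ltn_ord y.
rewrite [X in _ = _ * X]ifT; last by rewrite ltnS leq_subr.
case: (leqP y b) => yb; last first.
  rewrite (_ : (y == (b - (b - y))%N :> nat) = false) ?andbF ?mulr0; last by lia.
  case: ifP => _; last exact: scaler0.
  by rewrite (_ : (b == (y + (b - y))%N :> nat) = false) ?mul0r ?scaler0 //; lia.
rewrite subKn // eqxx andbT subnKC // eqxx mul1r.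
have [xE|xN] := eqVneq (x : nat) (c + (b - y))%N; last first.
  rewrite !mulr0; case: ifP => H; last exact: scaler0.
  by rewrite (_ : (c == (x - (b - y))%N :> nat) = false) ?mulr0 ?scaler0 //; lia.
rewrite mulr1 ifT; last by rewrite ltnS leq_min; apply/andP; split; lia.
rewrite xE addnK eqxx [X in _ *: X]mulr1 rcoefE ?leq_subr // subKn //.
rewrite subnK // /rdiag.
have scE (u z : C) : u *: (z : C^o) = u * z by [].
rewrite !scE (_ : c + (b - y) + y = b + c)%N; last by lia.
by rewrite !mulrA.
Qed.

Lemma nR_coord (i : 'I_n.-1) v e : nR R r i v e = fR q s r i (cf v) (cl e).
Proof.
set L := left_strand i; set K := right_strand i.
have LK : (L == K) = false by apply/eqP => /(congr1 val) /=; lia.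
rewrite fR_nth; last by rewrite size_cl; apply: right_strand_subproof.
rewrite (nth_cl e L) (nth_cl e K) ltn_ord mulr_sumr.
rewrite linext_ffun.
have nn (a d : nat) : size (set_nth 0%N (set_nth 0%N (cl e) i a) i.+1 d) = n.
  rewrite !size_set_nth size_cl (maxn_idPr (left_strand_subproof i)).
  exact: (maxn_idPr (right_strand_subproof i)).
rewrite /cf; under [RHS]eq_bigr do rewrite mulrA mulr_sumr big_mkcond /=.
rewrite exchange_big /=; apply: eq_bigr => e' _.
pose agree := [forall k, (k != L) && (k != K) ==> (e' k == e k)].
have -> : (\sum_p (Rmat R r (bvec C (e' L, e' K)) p : C) *:
      bvec C [ffun k => if k == L then p.1 else if k == K then p.2 else e' k]) e =
   if agree then Rmat R r (bvec C (e' L, e' K)) (e L, e K) else 0.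
  rewrite sum_ffunE (bigD1 (e L, e K)) //= big1 ?addr0 => [|p pe].
    rewrite !ffunE; case: ifP => [/forallP H|/negbT/forallPn[k]].
      rewrite [X in _ *: X](_ : _ = 1) ?[_ *: _]mulr1 //.
      rewrite (_ : _ == _) //; apply/eqP/ffunP => k; rewrite ffunE.
      have := H k; case: eqP => [->//|_]; case: eqP => [->//|_] /= /eqP -> //.
    rewrite negb_imply => /andP[/andP[kL kK] ne].
    rewrite [X in _ *: X](_ : _ = 0) ?[_ *: _]mulr0 //.
    rewrite (_ : (_ == _) = false) //; apply/eqP => /ffunP/(_ k).
    by rewrite ffunE (negbTE kL) (negbTE kK) => E; rewrite E eqxx in ne.
  rewrite !ffunE [X in _ *: X](_ : _ = 0) ?[_ *: _]mulr0 //.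
  rewrite (_ : (_ == _) = false) //; apply/eqP => /ffunP E.
  have := E L; have := E K; rewrite !ffunE !eqxx eq_sym LK => E1 E2.
  by move/eqP: pe; apply; rewrite E1 E2; case: (p).
have cond a : (cl e' == set_nth 0%N (set_nth 0%N (cl e) i (e K + a)%N) i.+1 (e L - a)%N)
   = agree && ((e' L == (e K + a)%N :> nat) && (e' K == (e L - a)%N :> nat)).
  apply/(cl_eqP _ (nn _ _))/idP => [H|/andP[/forallP H /andP[HL HK]] k].
    have := H L; have := H K; rewrite !nth_set_nth /= !nth_set_nth /= eqxx => -> .
    rewrite ltn_eqF // eqxx => ->; rewrite !eqxx !andbT.
    apply/forallP => k; apply/implyP => /andP[kL kK]; rewrite -(inj_eq val_inj) /=.
    rewrite (H k) nth_set_nth /= nth_set_nth /= nth_cl.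
    have /negbTE -> : (k != i.+1 :> nat) := kK.
    by have /negbTE -> : (k != i :> nat) := kL.
  rewrite nth_set_nth /= nth_set_nth /= nth_cl.
  have := H k; rewrite -!(inj_eq val_inj) /=.
  case: (nat_of_ord k =P i.+1) => [kK _|_].
    by rewrite (_ : k = K) ?(eqP HK) //; apply: val_inj.
  case: (nat_of_ord k =P i) => [kL _|_ /= /eqP //].
  by rewrite (_ : k = L) ?(eqP HL) //; apply: val_inj.
under [RHS]eq_bigr do rewrite cond.
case: (agree) => /=; last by rewrite mulr0 big1.
rewrite Rmat_coord mulr_sumr mulr_sumr; apply: eq_bigr => a _.
by case: ifP => _; rewrite ?mulr0 // mulr1 mulrC.
Qed.
End SteinbergCoordinates.

(** * The extension *)

Section BraidRepresentation.
Variables (K : fieldType) (vT : vectType K) (n : nat) (G : 'I_n.-1 -> 'End(vT)).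
Hypothesis G_inj : forall i, lker (G i) == 0%VS.
Hypothesis G_far : forall i j : 'I_n.-1, (i.+1 < j)%N ->
  G i \o G j =1 G j \o G i.
Hypothesis G_yb : forall i j : 'I_n.-1, j = i.+1 :> nat ->
  G i \o (G j \o G i) =1 G j \o (G i \o G j).

Definition letter_act (x : 'I_n.-1 * bool) : 'End(vT) :=
  if x.2 then (G x.1)^-1%VF else G x.1.

Definition word_act (w : braid_word n) : 'End(vT) :=
  foldr (fun x f => (letter_act x \o f)%VF) \1%VF w.

Lemma word_act_cat v w : word_act (v ++ w) = (word_act v \o word_act w)%VF.
Proof.
elim: v => [|x v IH] /=; first by rewrite comp_lfun1l.
by rewrite IH comp_lfunA.
Qed.

Lemma word_act_rel v w : braid_rel v w -> word_act v = word_act w.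
Proof.
elim=> {v w} //= [u v w _ -> _ -> //|v v' w w' _ ev _ ew|i b|i j ij|i j ij].
- by rewrite !word_act_cat ev ew.
- rewrite comp_lfun1r; case: b; rewrite /letter_act /=.
    exact: lker0_compVf.
  exact: lker0_compfV.
- by rewrite !comp_lfun1r; apply/lfunP => v; rewrite !comp_lfunE; apply: G_far.
- by rewrite !comp_lfun1r; apply/lfunP => v; rewrite !comp_lfunE; apply: G_yb.
Qed.

Definition braid_act (z : braid n) : 'End(vT) := word_act (repr z).

Lemma braid_act_pi w : braid_act (\pi_(braid n) w) = word_act w.
Proof. exact/word_act_rel/repr_pi_rel. Qed.

Lemma braid_act_rep : is_rep braid_act.
Proof.
split; first exact: (braid_act_pi [::]).
move=> g h; rewrite -{1}[g]reprK -{1}[h]reprK -braid_pi_cat braid_act_pi.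
exact: word_act_cat.
Qed.

Lemma braid_act_artin i : braid_act (artin i) = G i.
Proof. by rewrite /artin braid_act_pi /= comp_lfun1r. Qed.

Lemma braid_actM g h v : braid_act (g * h)%g v = braid_act g (braid_act h v).
Proof. by rewrite (proj2 braid_act_rep) comp_lfunE. Qed.

Lemma braid_act1 v : braid_act 1%g v = v.
Proof. by rewrite (proj1 braid_act_rep) id_lfunE. Qed.

Lemma braid_act_comm (X : 'End(vT)) g : (forall i, X \o G i =1 G i \o X) ->
  forall v, X (braid_act g v) = braid_act g (X v).
Proof.
move=> XG; rewrite /braid_act; elim: (repr g) => [|[i b] w IH] v /=.
  by rewrite !id_lfunE.
have Xl u : X (letter_act (i, b) u) = letter_act (i, b) (X u).
  case: b; last exact: XG.
  rewrite /letter_act /= -[LHS](lker0_lfunK (G_inj i)) -[G i (X _)]XG.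
  by congr (_^-1%VF (X _)); apply: lker0_lfunVK.
by rewrite !comp_lfunE Xl IH.
Qed.

Lemma mem_lker_comp2 (f g : 'End(vT)) v :
  (v \in lker ((f \o g) \o (f \o g))%VF) = (f (g (f (g v))) == 0).
Proof. by rewrite memv_ker !comp_lfunE. Qed.

(** By finite dimension an injective operator mapping [A] into itself maps it onto itself, so
    inverse letters preserve [A] too. *)
Lemma braid_act_stable (A : {vspace vT}) g :
  (forall i v, v \in A -> G i v \in A) ->
  forall v, v \in A -> braid_act g v \in A.
Proof.
move=> GA; rewrite /braid_act; elim: (repr g) => [|[i b] w IH] v vA /=.
  by rewrite id_lfunE.
rewrite comp_lfunE; case: b; last exact/GA/IH.
have GAA : (G i @: A)%VS = A.
  apply/eqP; rewrite eqEdim; apply/andP; split.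
    by apply/subvP => _ /memv_imgP[u uA ->]; apply: GA.
  by rewrite limg_dim_eq // (eqP (G_inj i)) capv0.
have := IH v vA; rewrite -{1}GAA => /memv_imgP[u uA ->].
by rewrite /letter_act /= lker0_lfunK.
Qed.

End BraidRepresentation.


(** * Extension and centre in a coordinate model *)

Section CoordinateModel.
Variables (C : fieldType) (q s : C) (r n : nat).
Variables (vT : vectType C) (cf : vT -> seq nat -> C).
Variables (nE nF : 'End(vT)) (nR : 'I_n.-1 -> 'End(vT)) (V : nat -> {vspace vT}).
Local Notation fE := (fE q s).
Local Notation fF := (fF q s).
Local Notation fR := (fR q s r).

Record coordinate_model : Prop := CoordinateModel {
  model_param : steinberg_param q s r;
  model_lin : forall a b v w,
    cf (a *: v + b *: w) = fun p => a * cf v p + b * cf w p;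
  model_inj : injective cf;
  model_range : forall v, in_range r (cf v);
  model_size : forall v p, size p != n -> cf v p = 0;
  model_surj : forall l phi, (l < r)%N -> supp n l phi -> exists v, cf v = phi;
  model_nE : forall v, cf (nE v) = fE (cf v);
  model_nF : forall v, cf (nF v) = fF (cf v);
  model_nR : forall i v, cf (nR i v) = fR i (cf v);
  model_V : forall l v, v \in V l <-> supp n l (cf v) }.

Hypothesis M : coordinate_model.
Let par := model_param M.
Let cf_lin := model_lin M.
Let cf_inj := model_inj M.
Let cf_range := model_range M.
Let cf_size := model_size M.
Let cf_surj := model_surj M.
Let cf_nE := model_nE M.
Let cf_nF := model_nF M.
Let cf_nR := model_nR M.
Let V_supp := model_V M.

Local Notation W l := (lker nE :&: V l)%VS.
Local Notation N l := (lker ((nF \o nE) \o (nF \o nE)) :&: V l)%VS.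

Lemma cf0 : cf 0 = fun=> 0.
Proof.
apply/funext => p; have /(congr1 (@^~ p)) := cf_lin 0 0 0 0.
by rewrite !scale0r addr0 !mul0r addr0.
Qed.

Lemma cf_eq0 v : (forall p, size p = n -> cf v p = 0) -> v = 0.
Proof.
move=> z; apply: cf_inj; rewrite cf0; apply/funext => p.
by have [/z|/cf_size ->] := eqVneq (size p) n.
Qed.

Lemma coord_nR_inj i : lker (nR i) == 0%VS.
Proof.
rewrite -subv0; apply/subvP => v; rewrite memv_ker memv0 => /eqP z; apply/eqP.
apply: cf_eq0 => p sp; apply: (fR_inj par (i := i)) => // [t _|].
  by rewrite -cf_nR z cf0.
by rewrite sp; apply: right_strand_subproof.
Qed.

Lemma coord_nR_far (i j : 'I_n.-1) : (i.+1 < j)%N -> nR i \o nR j =1 nR j \o nR i.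
Proof. by move=> ij v; apply: cf_inj; rewrite /= !cf_nR (fR_far par). Qed.

Lemma coord_nR_yb (i j : 'I_n.-1) : j = i.+1 :> nat ->
  nR i \o (nR j \o nR i) =1 nR j \o (nR i \o nR j).
Proof. by move=> ij v; apply: cf_inj; rewrite /= !cf_nR ij (fR_braid par). Qed.

Local Notation rho := (braid_act nR).

Lemma coord_action : is_rep rho /\ forall i, rho (artin i) = nR i.
Proof.
split; first exact: braid_act_rep coord_nR_inj coord_nR_far coord_nR_yb.
exact: braid_act_artin coord_nR_inj coord_nR_far coord_nR_yb.
Qed.

Let rhoM := braid_actM coord_nR_inj coord_nR_far coord_nR_yb.
Let rho1 := braid_act1 coord_nR_inj coord_nR_far coord_nR_yb.

Lemma rho_nE g v : nE (rho g v) = rho g (nE v).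
Proof.
apply: (braid_act_comm coord_nR_inj) => i u.
by apply: cf_inj; rewrite /= cf_nE !cf_nR cf_nE (fR_fE par).
Qed.

Lemma rho_nF g v : nF (rho g v) = rho g (nF v).
Proof.
apply: (braid_act_comm coord_nR_inj) => i u.
by apply: cf_inj; rewrite /= cf_nF !cf_nR cf_nF (fR_fF par).
Qed.

Lemma rho_V l g v : v \in V l -> rho g v \in V l.
Proof.
apply: (braid_act_stable coord_nR_inj) => i u /V_supp su; apply/V_supp => p.
by rewrite cf_nR; apply: (fR_supp par).
Qed.

Lemma mem_W l v : v \in W l <-> nE v = 0 /\ v \in V l.
Proof. by rewrite memv_cap memv_ker; split=> [/andP[/eqP]|[-> ->]]; rewrite ?eqxx. Qed.

Lemma mem_N l v : v \in N l <-> nF (nE (nF (nE v))) = 0 /\ v \in V l.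
Proof.
by rewrite memv_cap mem_lker_comp2; split=> [/andP[/eqP]|[-> ->]]; rewrite ?eqxx.
Qed.

Lemma rho_W l g v : v \in W l -> rho g v \in W l.
Proof.
move=> /mem_W[Ev vV]; apply/mem_W; rewrite rho_nE Ev linear0.
by split=> //; apply: rho_V.
Qed.

Lemma rho_N l g v : v \in N l -> rho g v \in N l.
Proof.
move=> /mem_N[Ev vV]; apply/mem_N; rewrite !(rho_nE, rho_nF) Ev linear0.
by split=> //; apply: rho_V.
Qed.

Lemma cf_rho_pos w v : all (fun i => i.+1 < n)%N w ->
  cf (rho (pos n w) v) = fRw q s r w (cf v).
Proof.
elim: w => [|i w IH] /=; first by rewrite rho1.
case/andP=> ni lw; rewrite pos_cons rhoM -IH //.
have ni' : (i < n.-1)%N by rewrite ltn_predRL.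
by rewrite (pos_artin (Ordinal ni')) (proj2 coord_action) cf_nR.
Qed.

Variable l : nat.
Hypothesis n_gt1 : (1 < n)%N.
Hypothesis l_lt : (l.+1 < r)%N.
Hypothesis q_r : q ^+ (n + 2 * l) = -1.
Hypothesis natC_inj : injective (fun k : nat => k%:R : C).

Let l_lt' : (l < r)%N := ltnW l_lt.

Lemma comm_EF v : v \in V l -> nE (nF v) = nF (nE v).
Proof.
move=> /V_supp sv; apply: cf_inj; rewrite cf_nE !cf_nF cf_nE; apply/funext => p.
rewrite (fE_fF par); have [->|/sv[sp lp]] := eqVneq (cf v p) 0.
  by rewrite mulr0 addr0.
have e : q^-1 ^+ n * q ^- (2 * l) = -1.
  by rewrite exprVn -invfM -exprD q_r invrN invr1.
have -> : commEF q s p = 0; last by rewrite mul0r addr0.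
(* In weight [l] the eigenvalue of [K] is a sign, hence equal to its inverse. *)
have w : wts q s p = - (-1) ^+ n.
  by rewrite wtsE sp lp (param_sE par) (exprNn q^-1) -mulrA e mulrN1.
rewrite /commEF w invrN; have -> : ((-1) ^+ n)^-1 = (-1) ^+ n :> C.
  by rewrite -exprVn invrN invr1.
by rewrite subrr mul0r.
Qed.

Lemma nE_V k v : v \in V k.+1 -> nE v \in V k.
Proof. by move=> /V_supp sv; apply/V_supp; rewrite cf_nE; apply: fE_supp. Qed.

Lemma nF_V k v : v \in V k -> nF v \in V k.+1.
Proof. by move=> /V_supp sv; apply/V_supp; rewrite cf_nF; apply: fF_supp. Qed.

Lemma nF_eq0 v : (forall p, cf v p != 0 -> (sumn p <= l)%N) -> nF v = 0 -> v = 0.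
Proof.
move=> sv Fv; apply: cf_eq0 => p sp.
apply: (fF_inj par l_lt sv); last by rewrite sp ltnW.
by move=> t; rewrite -cf_nF Fv cf0.
Qed.

Lemma V_le k v : v \in V k -> (k <= l)%N -> forall p, cf v p != 0 -> (sumn p <= l)%N.
Proof. by move=> /V_supp sv kl p /sv[_ ->]. Qed.

(** A bound instead of an exact weight covers [l = 0], where [nE v] would have weight [-1];
    injectivity of [F] asks for no more. *)
Lemma nE_le v : v \in V l -> forall p, cf (nE v) p != 0 -> (sumn p <= l)%N.
Proof.
move=> /V_supp sv p; rewrite cf_nE; apply: contraNT; rewrite -ltnNge => lp.
apply/eqP; rewrite -(fE0 q s p); apply: fE_ext => t _ et.
by apply/eqP; apply: contraT => /sv[_]; lia.
Qed.

(** In weight [l] the operators commute, so [F E F E v = 0] reads [F F E E v = 0], and [F] is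
    cancelled twice. *)
Lemma N_nE v : v \in N l.+1 -> nE v \in W l.
Proof.
move=> /mem_N[FEFE vV]; have EV := nE_V vV; apply/mem_W; split=> //.
apply: nF_eq0; first exact: nE_le.
apply: nF_eq0; last by rewrite -comm_EF.
by rewrite -comm_EF //; apply: V_le (nE_V (nF_V EV)) (leqnn l).
Qed.

Let predn1K : n.-1.+1 = n. Proof. by rewrite prednK // ltnW. Qed.

Lemma nE_surj w : w \in W l -> exists2 v, v \in N l.+1 & nE v = w.
Proof.
case/mem_W=> Ew /[dup] wV /V_supp sw.
have [|p|phi] := fE_solve par (m := n.-1) (l := l.+1)
    (phi0 := fun=> 0) (psi := cf w).
- by move=> p; rewrite eqxx.
- by case/sw => -> ->; rewrite predn1K.
rewrite predn1K => -[sphi Ephi _]; have [v vphi] := cf_surj l_lt sphi.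
have Ev : nE v = w by apply: cf_inj; rewrite cf_nE vphi.
exists v => //; apply/mem_N; split; last by apply/V_supp; rewrite vphi.
by rewrite Ev comm_EF // Ew !linear0.
Qed.

Lemma W_neq0 : exists2 w, w \in W l & w != 0.
Proof.
(* The slice [0] of a kernel vector is arbitrary. It consists of words of length [n - 1], nonempty
   as [n > 1], so it can carry the whole weight [l]. *)
pose p0 := l :: nseq n.-2 0%N.
have [|p|phi] := fE_solve par (m := n.-1) (l := l)
    (phi0 := fun p => (p == p0)%:R) (psi := fun=> 0).
- move=> p; case: (p =P p0) => [->|]; last by rewrite eqxx.
  move=> _; rewrite /= size_nseq sumn_nseq mul0n addn0; split=> //.
  by move: n_gt1; case: (n) => [|[]].
- by rewrite eqxx.
rewrite predn1K => -[sphi Ephi phi0]; have [w wphi] := cf_surj l_lt' sphi.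
exists w.
  apply/mem_W; split; last by apply/V_supp; rewrite wphi.
  by apply: cf_inj; rewrite cf_nE wphi cf0.
apply/eqP => w0; have := phi0 p0; rewrite -wphi w0 cf0 eqxx => /eqP.
by rewrite eq_sym oner_eq0.
Qed.

Lemma nF_W w : w \in W l -> nF w \in W l.+1.
Proof.
case/mem_W=> Ew wV; apply/mem_W; rewrite comm_EF // Ew linear0.
by split=> //; apply: nF_V.
Qed.

Lemma W_N v : v \in W l.+1 -> v \in N l.+1.
Proof. by case/mem_W=> Ev vV; apply/mem_N; rewrite Ev !linear0. Qed.

Lemma V_out k v p : v \in V k -> sumn p != k -> cf v p = 0.
Proof.
by move=> /V_supp sv; have [//|/sv[_ ->]] := eqVneq (cf v p) 0; rewrite eqxx.
Qed.

Local Notation T := (pos n (full_twist n)).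

Lemma fRw_wpow w k phi : fRw q s r (wpow w k) phi = iter k (fRw q s r w) phi.
Proof. by elim: k => //= k <-; rewrite wpowS /fRw foldr_cat. Qed.

Lemma rho_full_twist : exists theta c, [/\ theta != 0, c != 0 &
  forall v, v \in N l.+1 -> rho T v = theta *: (v + c *: nF (nE v))].
Proof.
have q0 := param_q_neq0 par; have s0 := s_neq0 par.
(* The constants of [full_twist_ker2] at length [n] and weight [l.+1]: [gams], and [{1} q^2] times
   the eigenvalue of [K]. *)
exists (s ^- (l.+1 * n) * kap q s n l.+1 ^- l.+1).
exists (brace q 1 * q ^+ 2 * (s ^+ n * q ^- (2 * l.+1))).
split.
- by rewrite mulf_neq0 ?invr_eq0 ?expf_neq0 ?(kap_neq0 par).
- by rewrite !mulf_neq0 ?invr_eq0 ?expf_neq0 ?(param_brace1_neq0 par).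
move=> v vN; have [FEFE vV] := (mem_N l.+1 v).1 vN.
have [EEv EV] := (mem_W l _).1 (N_nE vN).
set theta := _ * _; set c := _ * (_ * _).
have E : theta *: (v + c *: nF (nE v)) = theta *: v + (theta * c) *: nF (nE v).
  by rewrite scalerDr scalerA.
apply: cf_inj; apply/funext => p; rewrite E cf_lin.
have [pl|pl] := eqVneq (sumn p) l.+1; last first.
  by rewrite !(V_out _ pl) ?mulr0 ?addr0 // ?rho_V //; apply: nF_V.
have [sp|sp] := eqVneq (size p) n; last by rewrite !cf_size // !mulr0 addr0.
rewrite cf_rho_pos ?full_twist_lt // /full_twist fRw_wpow.
have EE0 : fE (fE (cf v)) = (fun=> 0) by rewrite -!cf_nE EEv cf0.
have := full_twist_ker2 par (m := n.-1) (cf_range v) EE0 (p := p).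
rewrite predn1K => /(_ sp) ->.
rewrite /gams sp pl predn1K -/theta cf_nF cf_nE wtsE sp pl -/c.
by rewrite mulrDr mulrA.
Qed.

Lemma nF_W_eq0 w : w \in W l -> nF w = 0 -> w = 0.
Proof. by case/mem_W=> _ wV; apply: nF_eq0; apply: V_le wV (leqnn l). Qed.

Lemma coord_extension : nontrivial_extension rho (W l) (W l.+1) (N l.+1).
Proof.
have sub (A : {vspace vT}) : (forall g v, v \in A -> rho g v \in A) -> submodule rho A.
  by move=> H g; apply/subvP => _ /memv_imgP[v vA ->]; apply: H.
exists nE.
  split.
  - by split; apply: sub => g v; [apply: rho_W|apply: rho_N|apply: rho_W].
  - by apply/subvP => v; apply: W_N.
  - split; last by move=> g v _; apply: rho_nE.
    by apply/subvP => _ /memv_imgP[v vN ->]; apply: N_nE.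
  - apply/eqP; rewrite eqEsubv; apply/andP; split.
      by apply/subvP => _ /memv_imgP[v vN ->]; apply: N_nE.
    by apply/subvP => w /nE_surj[v vN <-]; apply: memv_img.
  - apply/vspaceP => v; apply/idP/idP => [/memv_capP[/mem_N[_ vV]]|vW].
      by rewrite memv_ker => /eqP Ev; apply/mem_W.
    have [Ev _] := (mem_W _ _).1 vW.
    by apply/memv_capP; split; [apply: W_N | rewrite memv_ker Ev].
(* Since [E F E = F E E = 0] on [N], the full twist is the scalar [theta] on [W l]. An equivariant
   section [t] would give [theta t(w) = theta (t(w) + c F w)], hence [F w = 0]. *)
case=> t [tN trho] tK; have [theta [c [th0 c0 twist]]] := rho_full_twist.
have [w wW w0] := W_neq0.
have tw : t w \in N l.+1 by apply: (subvP tN); apply: memv_img.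
have Etw : nE (t w) = w by apply: tK.
have [Ew wV] := (mem_W _ _).1 wW.
have Tw : rho T w = theta *: w.
  rewrite -{1}Etw -rho_nE twist // linearZ linearD linearZ /= Etw comm_EF // Ew.
  by rewrite !linear0 addr0.
have := trho T w wW; rewrite Tw twist // linearZ /= Etw => /(scalerI th0).
move=> /eqP; rewrite -subr_eq0 opprD addNKr oppr_eq0 scaler_eq0 (negbTE c0) /=.
by move=> /eqP/(nF_W_eq0 wW) w0'; rewrite w0' eqxx in w0.
Qed.

(** Squaring [z T^k = Delta^m] gives [z^2 T^(2k) = T^m], so [T^m] and [T^(2k)] agree on [N]. As
    [T^a v = theta^a (v + a c F w)] with [w = E v], applying [E] identifies the powers of [theta],
    and the remaining terms give [m = 2k] in characteristic zero. Then
    [z T^k = Delta^(2k) = T^k]. *)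
Lemma coord_center_faithful : center_faithful_on rho (N l.+1).
Proof.
move=> z cz zN; have [k [m zT]] := central_braid n_gt1 cz.
have [theta [c [th0 c0 twist]]] := rho_full_twist.
have [w wW w0] := W_neq0; have [v vN Ev] := nE_surj wW.
have [Ew wV] := (mem_W _ _).1 wW.
have TF : rho T (nF w) = theta *: nF w.
  rewrite twist ?W_N ?nF_W // (comm_EF wV) Ew !linear0 addr0 //.
have Tk a : rho (T ^+ a)%g v = theta ^+ a *: (v + (a%:R * c) *: nF w).
  elim: a => [|a IH]; first by rewrite rho1 expr0 scale1r mul0r scale0r addr0.
  rewrite expgS rhoM IH linearZ linearD linearZ /= TF twist // Ev.
  rewrite (exprSr theta a) -[RHS]scalerA; congr (_ *: _).
  have -> : (a%:R * c) *: (theta *: nF w) = theta *: ((a%:R * c) *: nF w).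
    by rewrite !scalerA mulrC.
  rewrite -scalerDr -addrA -scalerDl; congr (_ *: (_ + _ *: _)).
  by rewrite -natr1; ring.
have HT : (T ^+ m)%g = ((pos n (half_twist n) ^+ m) ^+ 2)%g.
  by rewrite -(pos_half_sq n_gt1) expgnAC.
have zK u : u \in N l.+1 -> rho z u = u by apply: zN.
have e : rho (T ^+ m)%g v = rho (T ^+ (k + k))%g v.
  by rewrite HT -zT expg2 expgnDr !rhoM !zK // ?rho_N.
rewrite !Tk in e.
have NZ a : nE (theta ^+ a *: (v + (a%:R * c) *: nF w)) = theta ^+ a *: w.
  by rewrite linearZ linearD linearZ /= Ev (comm_EF wV) Ew !linear0 addr0.
have thE : theta ^+ m = theta ^+ (k + k).
  have := congr1 nE e; rewrite !NZ => /eqP.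
  by rewrite -subr_eq0 -scalerBl scaler_eq0 (negbTE w0) orbF subr_eq0 => /eqP.
move: e; rewrite thE => /(scalerI (expf_neq0 _ th0))/addrI/eqP.
rewrite -subr_eq0 -scalerBl scaler_eq0 -mulrBl mulf_eq0 (negbTE c0) orbF.
case/orP=> [|/eqP/(nF_W_eq0 wW) w0']; last by rewrite w0' eqxx in w0.
rewrite subr_eq0 => /eqP/natC_inj mk.
move: zT; rewrite mk addnn -mul2n expgnA (pos_half_sq n_gt1) -{2}[(_ ^+ k)%g]mul1g.
exact: mulIg.
Qed.
End CoordinateModel.

(** * The Steinberg tensor power as a coordinate model *)

Section Concrete.
Variables (R : realType) (r n : nat).
Hypothesis r_gt1 : (1 < r)%N.
Local Notation C := (R[i]).
Local Notation q := (q R r).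
Local Notation s := (s R r).
Local Notation vect := (Vn R r n).
Let par := steinberg_paramP R r_gt1.

Lemma cf_nE (v : vect) : cf (Defs.nE R r n v) = fE q s (cf v).
Proof.
apply: cf_eq => [|p sp|e]; last exact: nE_coord.
  exact/in_range_fE/cf_in_range.
by rewrite -[RHS](fE0 q s p); apply: fE_ext => t st _; rewrite cf_size // st.
Qed.

Lemma cf_nF (v : vect) : cf (Defs.nF R r n v) = fF q s (cf v).
Proof.
apply: cf_eq => [|p sp|e]; last exact: nF_coord.
  by apply: (in_range_fF par); apply: cf_in_range.
by rewrite -[RHS](fF0 q s p); apply: fF_ext => t st _; rewrite cf_size // st.
Qed.

Lemma cf_nR i (v : vect) : cf (Defs.nR R r i v) = fR q s r i (cf v).
Proof.
apply: cf_eq => [|p sp|e]; last exact: nR_coord.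
  by apply: (in_range_fR par); apply: cf_in_range.
transitivity (fR q s r i (fun t => 0 * cf v t) p).
  by apply: (fR_ext par) => t st _; rewrite mul0r cf_size // st.
by rewrite (fR_scale par) mul0r.
Qed.

Lemma cf_surj l phi : (l < r)%N -> supp n l phi -> exists v : vect, cf v = phi.
Proof.
move=> lr sp; exists [ffun e => phi (cl e)].
apply: cf_eq => [|p np|e]; last by rewrite ffunE.
  exact: (supp_in_range par lr sp).
by apply/eqP; apply: contraNT np => /sp[-> _].
Qed.

Lemma sumn_cl (e : {ffun 'I_n -> 'I_r}) : sumn (cl e) = (\sum_i e i)%N.
Proof. by rewrite sumnE /cl big_map big_enum. Qed.

Lemma Vnl_supp l (v : vect) : v \in Vnl R r n l <-> supp n l (cf v).
Proof.
pose X : seq vect := [seq bvec C e | e : {ffun 'I_n -> 'I_r} <-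
    enum {ffun 'I_n -> 'I_r} & (\sum_i e i)%N == l].
split=> [vV p|sv].
  have [sp|sp] := eqVneq (size p) n; last by rewrite cf_size // eqxx.
  have [rp|rp] := boolP (all (gtn r) p); last by rewrite cf_in_range // eqxx.
  have [e ep] := cl_surj sp rp; rewrite -ep cf_cl size_cl sumn_cl => ve.
  split=> //; apply/eqP; apply: contraR ve => el.
  have E := @coord_span _ _ _ (in_tuple X) v vV.
  rewrite E sum_ffunE big1 // => i _; rewrite ffunE.
  have /mapP[e' ] : X`_i \in X by apply: mem_nth; case: i.
  rewrite mem_filter => /andP[el' _] ->; rewrite ffunE.
  case: eqP => [ee|_]; last by rewrite scaler0.
  by rewrite ee el' in el.
have -> : v = \sum_e (v e : C) *: bvec C e.
  apply/ffunP => e; rewrite sum_ffunE (bigD1 e) //= big1 ?addr0 => [|e' ne].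
    by rewrite !ffunE eqxx [_ *: _]mulr1.
  by rewrite !ffunE eq_sym (negbTE ne) scaler0.
apply: memv_suml => e _.
have [->|ve] := eqVneq (v e) 0; first by rewrite scale0r mem0v.
apply/memvZ/memv_span/mapP; exists e => //.
rewrite mem_filter mem_enum andbT -sumn_cl; apply/eqP.
by case: (sv (cl e)); rewrite // cf_cl.
Qed.
Lemma steinberg_model : coordinate_model q s r (vT := Vn R r n) (@cf C r n)
  (nE R r n) (nF R r n) (@nR R r n) (Vnl R r n).
Proof.
split.
- exact: par.
- exact: cf_lin.
- exact: cf_inj.
- exact: cf_in_range.
- exact: cf_size.
- exact: cf_surj.
- exact: cf_nE.
- exact: cf_nF.
- exact: cf_nR.
- exact: Vnl_supp.
Qed.
End Concrete.

Lemma natC_inj (R : realType) : injective (fun k : nat => k%:R : R[i]).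
Proof. by move=> a b /eqP; rewrite eqr_nat => /eqP. Qed.

Theorem theorem1 (R : realType) (n l : nat) (hn : (2 <= n)%N) (hl : (1 <= l)%N) :
  exists r l' : nat,
    [/\ (2 <= r)%N, (l' < l)%N, (l < r)%N,
        (l'%:Z + l%:Z = 1 - n%:Z %[mod r%:Z])%Z
      & exists rho : braid n -> 'End(Vn R r n),
          [/\ is_braid_action rho,
              nontrivial_extension rho (Wnl R r n l') (Wnl R r n l)
                (Nnl R r n l l')
            & center_faithful_on rho (Nnl R r n l l')]].
Proof.
case: l hl => // l _; set r := (n + 2 * l)%N.
have r_gt1 : (1 < r)%N by rewrite /r; lia.
have l_lt : (l.+1 < r)%N by rewrite /r; lia.
exists r, l; split=> //.
  (* The difference of the two sides is [r] itself. *)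
  apply/eqP; rewrite eqz_mod_dvd (_ : _ - _ = r%:Z) ?dvdzz // /r; lia.
have M := steinberg_model R n r_gt1.
have q_r : q R r ^+ (n + 2 * l) = -1 by apply: q_expr.
exists (braid_act (@nR R r n)); split.
- exact: coord_action M.
- exact: (coord_extension M hn l_lt q_r).
- exact: (coord_center_faithful M hn l_lt q_r (@natC_inj R)).
Qed.
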